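(* Let $T>0$, let $A,C\in L^\infty(0,T;\mathbb{R}^{n\times n})$, $B,D\in L^\infty(0,T;\mathbb{R}^{n\times m})$, $G\in C([0,T];\mathbb{S}^n)$, $Q\in C([0,T]^2;\mathbb{S}^n)$, $R\in C([0,T]^2;\mathbb{S}^m)$. Assume: (i) there is a constant $\delta>0$ such that $Q(t,s)\ge 0$, $R(t,s)\ge \delta I$, $G(t)\ge 0$ for all $0\le t\le s\le T$; (ii) there are positive definite matrices $\widehat Q,\widehat R,\widehat G$ such that for all $0\le t\le r\le s\le T$, $Q(t,s)\le Q(r,s)\le\widehat Q$, $R(t,s)\le R(r,s)\le\widehat R$, $G(t)\le G(r)\le\widehat G$. Then the equilibrium Riccati equation $$\begin{cases}\partial_sP(t,s)+P(t,s)A_\Theta(s)+A_\Theta(s)^\top P(t,s)+C_\Theta(s)^\top P(t,s)C_\Theta(s)\\ \qquad+Q(t,s)+\Theta(s)^\top R(t,s)\Theta(s)=0,\quad 0\le t\le s\le T,\\ P(t,T)=G(t),\quad 0\le t\le T,\end{cases}$$ where $$\Theta(s)=-[R(s,s)+D(s)^\top P(s,s)D(s)]^{-1}[B(s)^\top P(s,s)+D(s)^\top P(s,s)C(s)],$$ $$A_\Theta(s)=A(s)+B(s)\Theta(s),\qquad C_\Theta(s)=C(s)+D(s)\Theta(s),$$ admits a unique solution $P\in C(\Delta^*[0,T];\mathbb{S}^n_+)$. Moreover, for this solution $P$, the function $\Theta(s)=-[R(s,s)+D(s)^\top P(s,s)D(s)]^{-1}[B(s)^\top P(s,s)+D(s)^\top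 P(s,s)C(s)]$, $s\in[0,T]$, belongs to $L^\infty(0,T;\mathbb{R}^{m\times n})$.
   Context: $\mathbb{S}^n$ is the space of symmetric real $n\times n$ matrices, $\mathbb{S}^n_+$ the subset of positive semi-definite ones, and inequalities between symmetric matrices are in the positive semi-definite (Loewner) order. $\Delta^*[0,T]=\{(t,s)\in[0,T]^2: t\le s\}$; $C(\Delta^*[0,T];\mathbb{S}^n_+)$ is the set of continuous functions on $\Delta^*[0,T]$ with values in $\mathbb{S}^n_+$. The equation is non-local: the coefficient $\Theta(s)$ depends on the unknown $P$ through its diagonal value $P(s,s)$. Since $A,B,C,D$ are only bounded and measurable, a solution is understood in the integrated sense: for each $t$, $s\mapsto P(t,s)$ is absolutely continuous on $[t,T]$, satisfies the displayed equation for almost every $s\in[t,T]$, and satisfies the terminal condition. *)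

(* Defs.v *)
From HB Require Import structures.
From mathcomp Require Import all_boot all_order all_algebra.
From mathcomp Require Import all_classical all_reals all_analysis.

Set Implicit Arguments.
Unset Strict Implicit.
Unset Printing Implicit Defensive.

Import Order.TTheory GRing.Theory Num.Theory.
Import numFieldNormedType.Exports.

Local Open Scope classical_set_scope.
Local Open Scope ring_scope.

Definition symm (K : realType) (n : nat) (M : 'M[K]_n) : Prop := M^T = M.

Definition psd (K : realType) (n : nat) (M : 'M[K]_n) : Prop :=
  symm M /\ forall x : 'cV[K]_n, 0 <= (x^T *m M *m x) 0 0.

Definition posdef (K : realType) (n : nat) (M : 'M[K]_n) : Prop :=
  symm M /\ forall x : 'cV[K]_n, x != 0 -> 0 < (x^T *m M *m x) 0 0.

Definition loewner (K : realType) (n : nat) (M N : 'M[K]_n) : Prop :=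
  psd (N - M).

(* [lebesgue_measure] lives on the Borel sigma-algebra, and an element of
   L^oo(0,T) is a class modulo a.e. equality.  So F is asked to agree a.e. on
   [0,T] with a Borel, essentially bounded F0: exactly the Lebesgue measurable,
   essentially bounded F qualify, whatever their values on null sets. *)
Definition Linfty (K : realType) (T : K) (p q : nat) (F : K -> 'M[K]_(p, q)) :
    Prop :=
  exists F0 : K -> 'M[K]_(p, q),
    (forall i j, (fun s => F0 s i j) \in Lfun (@lebesgue_measure K) +oo%E) /\
    {ae (@lebesgue_measure K), forall s : K, `[0, T]%classic s -> F s = F0 s}.

Definition abs_continuous (K : realType) (V : normedModType K) (a b : K)
    (f : K -> V) : Prop :=
  forall e : K, 0 < e -> exists2 d : K, 0 < d &
    forall (N : nat) (u v : 'I_N -> K),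
      (forall i, a <= u i /\ u i <= v i /\ v i <= b) ->
      trivIset [set: 'I_N] (fun i => `]u i, v i[%classic) ->
      \sum_(i < N) (v i - u i) < d ->
      \sum_(i < N) `|f (v i) - f (u i)| < e.

(* Functions on [0,T], [0,T]^2 and the triangle are total functions on K or
   K -> K -> _; only their values on the domain are ever constrained. *)
Definition triangle (K : realType) (T : K) : set (K * K) :=
  [set p | 0 <= p.1 /\ p.1 <= p.2 /\ p.2 <= T].

Definition Theta (K : realType) (n m : nat)
    (B : K -> 'M[K]_(n, m)) (C : K -> 'M[K]_n) (D : K -> 'M[K]_(n, m))
    (R : K -> K -> 'M[K]_m) (P : K -> K -> 'M[K]_n) (s : K) : 'M[K]_(m, n) :=
  - (invmx (R s s + (D s)^T *m P s s *m D s)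
     *m ((B s)^T *m P s s + (D s)^T *m P s s *m C s)).

Definition riccati_solution (K : realType) (n m : nat) (T : K)
    (A : K -> 'M[K]_n) (B : K -> 'M[K]_(n, m))
    (C : K -> 'M[K]_n) (D : K -> 'M[K]_(n, m))
    (G : K -> 'M[K]_n) (Q : K -> K -> 'M[K]_n) (R : K -> K -> 'M[K]_m)
    (P : K -> K -> 'M[K]_n) : Prop :=
  let Th := Theta B C D R P in
  let ATh s := A s + B s *m Th s in
  let CTh s := C s + D s *m Th s in
  [/\ {within triangle T, continuous (fun p : K * K => P p.1 p.2)},
      forall t s : K, triangle T (t, s) -> psd (P t s),
      forall t : K, `[0, T]%classic t -> abs_continuous t T (P t),
      forall t : K, `[0, T]%classic t ->
        {ae (@lebesgue_measure K), forall s : K, `[t, T]%classic s ->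
          derivable (P t) s 1 /\
          derive1 (P t) s + P t s *m ATh s + (ATh s)^T *m P t s
          + (CTh s)^T *m P t s *m CTh s
          + Q t s + (Th s)^T *m R t s *m Th s = 0}
    & forall t : K, `[0, T]%classic t -> P t T = G t].

(* Main.v *)
Require Import Defs.
From mathcomp Require Import all_boot all_order all_algebra.
From mathcomp Require Import all_classical all_reals all_analysis.
From mathcomp Require Import measurable_realfun ess_sup_inf ring lra.
Import Order.TTheory GRing.Theory Num.Theory.
Import numFieldNormedType.Exports.
Local Open Scope classical_set_scope.
Local Open Scope ring_scope.

(* The gain Theta is made globally bounded and Lipschitz in P(s,s) by replacing
   P(s,s) with a bounded matrix having a nonnegative quadratic form, which leaves
   it unchanged when it is positive semidefinite and small enough.  The resulting
   equation is solved on [0,T] by Picard iteration in an exponentially weighted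
   norm.  Lyapunov equations with nonnegative data have nonnegative solutions, so
   P(t,s) >= 0 and, by monotonicity of the data in t, P(t,s) <= P(s,s).  As Theta
   minimises the quadratic form attached to P(s,s), this yields a bound
   P(s,s) <= b exp(k(T-s)) I independent of the truncation level; for a large
   level the truncation is thus inactive.  Two solutions of the original equation
   solve the same truncated equation for a large level, hence coincide.
   Absolute continuity enters only through the fact that an absolutely continuous
   function with a.e. nonnegative derivative is nondecreasing. *)

(** The diagonal P(s,s) obeys no differential equation of its own: the data are only continuous in
    t, so it need not be absolutely continuous in s. Comparison arguments are therefore run backward
    from T up to a first contact, where a single row P(s0, .) is differentiated and the diagonal
    enters by continuity only. Picard iterates are not known to be symmetric or nonnegative, yet R +
    D^T q D has to be invertible along all of them; this is why q is shifted by a multiple of the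
    identity before its norm is cut, and why symmetry is recovered afterwards by a uniqueness
    argument. On a positive semidefinite matrix the cut is a multiplication by some l in (0,1],
    under which the minimality of the gain survives; hence a bound free of the truncation level. *)

Set Implicit Arguments.
Unset Strict Implicit.
Unset Printing Implicit Defensive.

(** * Absolutely continuous functions *)

(** Continuous induction. The step carries [P] across [s], from points on its left to points on its
    right, so it serves both to reach the supremum of the set where [P] holds and to pass beyond
    it. *)
Lemma real_induction (K : realType) (P : K -> Prop) (a b : K) : a <= b -> P a ->
  (forall s, a <= s <= b -> exists2 r, 0 < r & forall x y, a <= x -> s - r < x ->
     x <= s -> s <= y -> y < s + r -> y <= b -> P x -> P y) -> P b.
Proof.
move=> ab Pa step.
pose E := [set x : K | a <= x <= b /\ P x].
have Ea : E a by rewrite /E/= lexx ab.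
have supE : has_sup E.
  by split; [exists a|exists b => x [/andP[_ xb] _]].
have as_ : a <= sup E by apply: (sup_upper_bound supE).
have sb : sup E <= b by apply: ge_sup; [exists a|move=> x [/andP[_ ->]]].
have [|r r0 H] := step (sup E); first by rewrite as_.
have [x [/andP[ax xb] Px] sx] := sup_adherent r0 supE.
have xs : x <= sup E by apply: (sup_upper_bound supE); rewrite /E/= ax xb.
have [bs|bs] := leP b (sup E).
  by apply: (H x b) => //; rewrite (le_lt_trans bs)// ltrDl.
pose y := Num.min b (sup E + r / 2).
have sy : sup E < y by rewrite /y lt_min bs ltrDl divr_gt0.
have yb : y <= b by rewrite /y ge_min lexx.
have Py : P y.
  apply: (H x y) => //; first exact: ltW.
  by rewrite /y gt_min ltrD2l; apply/orP; right; lra.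
suff : y <= sup E by rewrite leNgt sy.
apply: (sup_upper_bound supE); rewrite /E/= yb; split => //.
by rewrite andbT (le_trans as_)// ltW.
Qed.

Lemma real_induction_backward (K : realType) (P : K -> Prop) (a b : K) : a <= b -> P b ->
  (forall s, a <= s <= b -> exists2 r, 0 < r & forall x y, a <= x -> s - r < x ->
     x <= s -> s <= y -> y < s + r -> y <= b -> P y -> P x) -> P a.
Proof.
move=> ab Pb step.
rewrite -[a]opprK; apply: (@real_induction _ (P \o -%R) (- b)) => /=;
  rewrite ?lerN2 ?opprK// => s /andP[bs sa].
have [|r r0 H] := step (- s); first by apply/andP; split; lra.
exists r => // x y bx sx xs sy ys ya.
by apply: H; lra.
Qed.

Section abs_continuity.
Variable K : realType.

(** Source of most closure properties used later: a function inherits absolute continuity when its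
    increments are dominated by those of a known one, possibly with values in another space. *)
Lemma abs_continuous_lip (V W : normedModType K) (a b c : K) (f : K -> V) (g : K -> W) :
  (forall x y, a <= x <= b -> a <= y <= b -> `|g y - g x| <= c * `|f y - f x|) ->
  abs_continuous a b f -> abs_continuous a b g.
Proof.
move=> gf acf e e0.
have c0 : 0 < `|c| + 1 by rewrite ltr_wpDl.
have [d d0 H] := acf (e / (`|c| + 1)) (divr_gt0 e0 c0).
exists d => // N u v uv tr suv.
have := H N u v uv tr suv; rewrite ltr_pdivlMr// mulr_suml; apply: le_lt_trans.
apply: ler_sum => i _; have [au [uvi vb]] := uv i.
apply: le_trans (gf _ _ _ _) _; rewrite ?au ?(le_trans uvi vb)// ?vb ?(le_trans au uvi)//.
by rewrite mulrC ler_wpM2l// (le_trans (ler_norm _))// lerDl.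
Qed.

Lemma abs_continuous_id (a b : K) : abs_continuous a b (id : K -> K).
Proof.
move=> e e0; exists e => // N u v uv _.
by under eq_bigr => i _ do rewrite -[v i - u i]ger0_norm ?subr_ge0 ?(uv i).2.1//.
Qed.

Lemma lipschitz_abs_continuous (V : normedModType K) (a b c : K) (f : K -> V) :
  (forall x y, a <= x <= b -> a <= y <= b -> `|f y - f x| <= c * `|y - x|) ->
  abs_continuous a b f.
Proof. move=> fc; exact: (abs_continuous_lip fc (abs_continuous_id a b)). Qed.

Lemma abs_continuousS (V : normedModType K) (a b a' b' : K) (f : K -> V) :
  a <= a' -> b' <= b -> abs_continuous a b f -> abs_continuous a' b' f.
Proof.
move=> aa bb acf e /acf[d d0 H]; exists d => // N u v uv; apply: H => i.
have [? [? ?]] := uv i; split; [exact: le_trans aa _|split => //].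
exact: le_trans bb.
Qed.

Lemma abs_continuousD (V : normedModType K) (a b : K) (f g : K -> V) :
  abs_continuous a b f -> abs_continuous a b g ->
  abs_continuous a b (fun s => f s + g s).
Proof.
move=> acf acg e e0; have e2 : 0 < e / 2 by rewrite divr_gt0.
have [d d0 H] := acf _ e2; have [d' d'0 H'] := acg _ e2.
exists (Num.min d d'); first by rewrite lt_min d0.
move=> N u v uv tr; rewrite lt_min => /andP[sd sd'].
have := ltrD (H N u v uv tr sd) (H' N u v uv tr sd').
rewrite -big_split/= -splitr; apply: le_lt_trans; apply: ler_sum => i _.
by rewrite opprD addrACA ler_normD.
Qed.

Lemma abs_continuousZ (V : normedModType K) (a b c : K) (f : K -> V) :
  abs_continuous a b f -> abs_continuous a b (fun s => c *: f s).
Proof.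
by apply: (@abs_continuous_lip _ _ _ _ `|c|) => x y _ _; rewrite -scalerBr normrZ.
Qed.

Lemma abs_continuousB (V : normedModType K) (a b : K) (f g : K -> V) :
  abs_continuous a b f -> abs_continuous a b g ->
  abs_continuous a b (fun s => f s - g s).
Proof.
move=> acf acg; apply: abs_continuousD => //.
by apply: (@abs_continuous_lip _ _ _ _ 1 g) => // x y _ _; rewrite -opprD normrN mul1r.
Qed.

End abs_continuity.

(** * Monotonicity from an almost everywhere nonnegative derivative *)

Section ac_nondecreasing.
Variable K : realType.

(** By additivity the sum of the lengths is the measure of the disjoint union, which lies in [U]. *)
Lemma sum_itv_lt (N : nat) (u v : 'I_N -> K) (U : set K) (d : K) :
  open U -> (@lebesgue_measure K U < d%:E)%E ->
  (forall i, u i <= v i) -> trivIset [set: 'I_N] (fun i => `]u i, v i[%classic) ->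
  (forall i, `]u i, v i[%classic `<=` U) ->
  \sum_(i < N) (v i - u i) < d.
Proof.
move=> oU Ud uv tr sub; rewrite -lte_fin -sumEFin; apply: le_lt_trans Ud.
have -> : (\sum_(i < N) (v i - u i)%:E)%E =
    (\sum_(i < N) @lebesgue_measure K `]u i, v i[%classic)%E.
  apply: eq_bigr => i _; rewrite lebesgue_measure_itv/= lte_fin EFinB.
  case: ltP => // vu; have -> : u i = v i by apply/eqP; rewrite eq_le uv vu.
  by rewrite subee.
rewrite -measure_bigsetU_ord//; apply: le_measure; rewrite ?inE.
- by apply: bigsetU_measurable => i _ /=.
- exact: open_measurable.
- by elim/big_ind : _ => // A B AU BU; rewrite subUset.
Qed.

Variables (f : K -> K) (U : set K) (a : K).

(* S is the variation of f over finitely many disjoint subintervals of [a, x]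
   lying in U.  For U an open set of small measure containing the exceptional null
   set, S is small by absolute continuity; f increases up to an error e (x - a) + S,
   the part S absorbing the passage through the points of U. *)
Let fam (x S : K) := exists (N : nat) (u v : 'I_N -> K),
  [/\ forall i, a <= u i /\ u i <= v i /\ v i <= x,
      trivIset [set: 'I_N] (fun i => `]u i, v i[%classic),
      forall i, `]u i, v i[%classic `<=` U &
      S = \sum_(i < N) `|f (v i) - f (u i)|].

Let fam0 x : fam x 0.
Proof.
exists 0%N, (fun=> 0), (fun=> 0); split; rewrite ?big_ord0//; by [case|case=> ? []].
Qed.

Let famW x y S : x <= y -> fam x S -> fam y S.
Proof.
move=> xy [N [u [v [uv tr sub ->]]]]; exists N, u, v; split=> // i.
have [? [? ?]] := uv i; split => //; split => //; exact: le_trans xy.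
Qed.

(** The new interval gets index 0; the earlier ones end at or before [x], which keeps the family
    disjoint. *)
Let fam_ext x y S : a <= x -> x <= y -> `]x, y[%classic `<=` U -> fam x S ->
  fam y (`|f y - f x| + S).
Proof.
move=> ax xy xyU [N [u [v [uv tr sub ->]]]].
pose u' i := oapp u x (unlift ord0 i); pose v' i := oapp v y (unlift ord0 i).
exists N.+1, u', v'; split.
- move=> i; rewrite /u' /v'; case: (unliftP ord0 i) => [j _|_] //=.
  have [? [? ?]] := uv j; split => //; split => //; exact: le_trans xy.
- move=> i j _ _ [z] /=; rewrite /u' /v'.
  case: (unliftP ord0 i) => [i' ->|->]; case: (unliftP ord0 j) => [j' ->|->] //=.
  + rewrite /= => -[zi zj]; congr lift; apply: tr => //; by exists z.
  + rewrite !in_itv/= => -[/andP[_ zv] /andP[xz _]].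
    by have [_ [_ /(lt_le_trans zv)/(lt_trans xz)]] := uv i'; rewrite ltxx.
  + rewrite !in_itv/= => -[/andP[xz _] /andP[_ zv]].
    by have [_ [_ /(lt_le_trans zv)/(lt_trans xz)]] := uv j'; rewrite ltxx.
- by move=> i; rewrite /u' /v'; case: (unliftP ord0 i) => [j _|_] //=.
- by rewrite big_ord_recl {1 2}/u' {1 2}/v' unlift_none/=; congr (_ + _);
    apply: eq_bigr => i _; rewrite /u' /v' liftK.
Qed.


(** One step of the continuous induction. If [s] lies in [U], a whole neighbourhood does, and the
    increment across it joins the variation [S]. Otherwise the derivative at [s] is nonnegative, and
    the increments on either side lose at most [e] times their length. *)
Let step (b e s : K) : 0 < e -> a <= s <= b -> open U ->
  (~ U s -> [/\ a < s, s < b, derivable f s 1 & 0 <= derive1 f s]) ->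
  exists2 r, 0 < r & forall x y, a <= x -> s - r < x -> x <= s -> s <= y -> y < s + r -> y <= b ->
    (exists2 S, fam x S & f a - e * (x - a) - S <= f x) ->
    (exists2 S, fam y S & f a - e * (y - a) - S <= f y).
Proof.
move=> e0 /andP[as_ sb] oU nU.
have [Us|/nU[{}as_ {}sb df f's]] := pselect (U s).
  have /nbhs_ballP[r /= r0 sU] : nbhs s U by exact: open_nbhs_nbhs.
  exists r => // x y ax sx xs sy ys yb [S fS fx].
  exists (`|f y - f x| + S).
    apply: fam_ext fS => //; first exact: le_trans sy.
    move=> z /=; rewrite in_itv/= => /andP[xz zy]; apply: sU.
    by rewrite /ball/= ltr_distl; apply/andP; split; lra.
  have := ler_norm (f x - f y); rewrite distrC.
  have : e * (x - a) <= e * (y - a) by rewrite ler_pM2l//; lra.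
  lra.
have /cvgrPdist_lt/(_ e e0)[r /= r0 H] :
    (fun h => h^-1 *: (f (h *: (1:K) + s) - f s)) @ 0^' --> derive1 f s.
  by rewrite derive1E; exact: df.
have key h : 0 < `|h| -> `|h| < r -> - e < h^-1 * (f (h + s) - f s).
  move=> h0 hr; have := H h; rewrite /= sub0r normrN => /(_ hr).
  rewrite -normr_gt0 => /(_ h0); rewrite ltr_norml => /andP[_].
  rewrite scaler1 /GRing.scale/=; lra.
exists r => // x y ax sx xs sy ys yb [S fS fx].
exists S; first by apply: famW fS; exact: le_trans sy.
have fxs : f x <= f s + e * (s - x).
  have [->|xs'] := eqVneq x s; first by rewrite subrr mulr0 addr0.
  have xls : x < s by rewrite lt_neqAle xs'.
  have : - e < (x - s)^-1 * (f (x - s + s) - f s).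
    by apply: key; rewrite ltr0_norm; lra.
  rewrite subrK.
  have -> : (x - s)^-1 * (f x - f s) = - ((f x - f s) / (s - x)).
    by field; rewrite !subr_eq0 xs' eq_sym xs'.
  rewrite ltrN2 ltr_pdivrMr ?subr_gt0//; lra.
have fsy : f s <= f y + e * (y - s).
  have [->|ys'] := eqVneq y s; first by rewrite subrr mulr0 addr0.
  have sly : s < y by rewrite lt_neqAle eq_sym ys'.
  have : - e < (y - s)^-1 * (f (y - s + s) - f s).
    by apply: key; rewrite gtr0_norm; lra.
  rewrite subrK.
  rewrite mulrC ltr_pdivlMr ?subr_gt0//; lra.
lra.
Qed.

Lemma ac_nondecreasing_aux (b e : K) : a <= b -> 0 < e -> open U ->
  (forall s, a <= s <= b -> ~ U s -> [/\ a < s, s < b, derivable f s 1 & 0 <= derive1 f s]) ->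
  (forall (N : nat) (u v : 'I_N -> K), (forall i, a <= u i /\ u i <= v i /\ v i <= b) ->
      trivIset [set: 'I_N] (fun i => `]u i, v i[%classic) ->
      (forall i, `]u i, v i[%classic `<=` U) ->
      \sum_(i < N) `|f (v i) - f (u i)| < e) ->
  f a <= f b + e * (b - a + 1).
Proof.
move=> ab e0 oU nU small.
have [S [N [u [v [uv tr sub ->]]]]] : exists2 S, fam b S & f a - e * (b - a) - S <= f b.
  apply: (@real_induction _ (fun x => exists2 S, fam x S & f a - e * (x - a) - S <= f x) a) => //.
    by exists 0; [exact: fam0|lra].
  by move=> s asb; apply: step => // nUs; exact: nU.
have := small N u v uv tr sub; lra.
Qed.

End ac_nondecreasing.

Lemma ac_nondecreasing (K : realType) (f : K -> K) (a b : K) : a <= b ->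
  abs_continuous a b f ->
  {ae @lebesgue_measure K, forall s, `]a, b[%classic s -> derivable f s 1 /\ 0 <= derive1 f s} ->
  f a <= f b.
Proof.
move=> ab acf aef; apply/ler_addgt0Pr => e' e'0.
have l0 : 0 < b - a + 1 by lra.
(* The loss is [e * (b - a)] along the good points plus less than [e] from the variation inside [U],
   hence the [+ 1]. *)
pose e := e' / (b - a + 1); have e0 : 0 < e by rewrite divr_gt0.
have [d d0 dP] := acf e e0.
(* The end points join the null set, so that every point of [a,b] outside [U] is interior. *)
have : (@lebesgue_measure K).-negligible
    (~` [set s | `]a, b[%classic s -> derivable f s 1 /\ 0 <= derive1 f s] `|`
     ([set a] `|` [set b])).
  do 2 apply: negligibleU => //;
    by apply/negligibleP; [exact: measurable_set1|exact: lebesgue_measure_set1].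
move=> [N [mN muN subN]].
have muNy : (@lebesgue_measure K N < +oo)%E by rewrite muN ltry.
have [U [oU NU UN]] := lebesgue_regularity_outer mN muNy d0.
have muU : (@lebesgue_measure K U < d%:E)%E.
  have mU := open_measurable oU; apply: le_lt_trans UN.
  have -> : @lebesgue_measure K U =
      (lebesgue_measure (U `\` N) + lebesgue_measure (U `&` N))%E by exact: measureDI.
  rewrite (_ : lebesgue_measure (U `&` N) = 0%E) ?adde0//.
  by apply: (subset_measure0 _ mN _ muN) => //; exact: measurableI.
have -> : e' = e * (b - a + 1) by rewrite /e divfK// gt_eqF.
apply: (@ac_nondecreasing_aux _ _ U) => //.
- move=> s /andP[as_ sb] nUs.
  have nNs : ~ N s by move=> /NU.
  have nsa : s != a by apply/eqP => sa; apply/nNs/subN; right; left.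
  have nsb : s != b by apply/eqP => sb'; apply/nNs/subN; right; right.
  have {}as_ : a < s by rewrite lt_neqAle eq_sym nsa.
  have {}sb : s < b by rewrite lt_neqAle nsb.
  suff [? ?] : derivable f s 1 /\ 0 <= derive1 f s by [].
  apply: contrapT => ns; apply/nNs/subN; left => /= H; apply: ns; apply: H.
  by rewrite in_itv/= as_.
- move=> N' u v uv tr sub; apply: dP => //.
  by apply: (sum_itv_lt oU muU) => // i; have [_ []] := uv i.
Qed.

(** * Largest-entry norm and derivatives of matrix functions *)

Section matrix_norm.
Variable K : realType.

Lemma mx_norm_entry p q (M : 'M[K]_(p, q)) i j : `|M i j| <= `|M|.
Proof.
rewrite [leRHS]/Num.Def.normr/= mx_normrE.
exact: (le_bigmax _ (fun ij => `|M ij.1 ij.2|) (i, j)).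
Qed.

Lemma mx_norm_le p q (M : 'M[K]_(p, q)) c : 0 <= c ->
  (forall i j, `|M i j| <= c) -> `|M| <= c.
Proof.
move=> c0 Mc; rewrite [leLHS]/Num.Def.normr/= mx_normrE.
by apply: bigmax_le => // -[i j] _; exact: Mc.
Qed.

(** The largest-entry norm is submultiplicative only up to the inner dimension; the powers of n and
    m in later constants come from here. *)
Lemma mx_norm_mulmx p q r (M : 'M[K]_(p, q)) (N : 'M[K]_(q, r)) :
  `|M *m N| <= q%:R * (`|M| * `|N|).
Proof.
apply: mx_norm_le => [|i j]; first by rewrite !mulr_ge0.
rewrite mxE; apply: le_trans (ler_norm_sum _ _ _) _.
rewrite (@le_trans _ _ (\sum_(k < q) `|M| * `|N|))//.
  by apply: ler_sum => k _; rewrite normrM ler_pM// mx_norm_entry.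
by rewrite sumr_const card_ord mulr_natl.
Qed.

Lemma mx_norm_trmx p q (M : 'M[K]_(p, q)) : `|M^T| = `|M|.
Proof.
have H p' q' (N : 'M[K]_(p', q')) : `|N^T| <= `|N|.
  by apply: mx_norm_le => // i j; rewrite mxE mx_norm_entry.
by apply/eqP; rewrite eq_le H -{1}[M]trmxK H.
Qed.

Lemma is_derive_entry p q (u : K -> 'M[K]_(p, q)) (s : K) v i j :
  is_derive s (1 : K) u v -> is_derive s (1 : K) (fun s => u s i j) (v i j).
Proof.
move=> [du <-]; have dij := (derivable_mxP u s 1).1 du.
by apply: DeriveDef => //; rewrite derive_mx// mxE.
Qed.

Lemma is_derive_mx p q (u : K -> 'M[K]_(p, q)) (s : K) (v : 'M[K]_(p, q)) :
  (forall i j, is_derive s (1 : K) (fun s => u s i j) (v i j)) -> is_derive s (1 : K) u v.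
Proof.
move=> h; have du : derivable u s 1 by apply/derivable_mxP => i j; case: (h i j).
apply: DeriveDef => //; rewrite derive_mx//.
by apply/matrixP => i j; rewrite mxE; case: (h i j).
Qed.

Section pointwise.
Variables (V : normedModType K) (f g : K -> V) (s : K) (v w : V).
Hypotheses (df : is_derive s (1 : K) f v) (dg : is_derive s (1 : K) g w).

Lemma is_derive_opp : is_derive s (1 : K) (fun x => - f x) (- v).
Proof. exact: (@is_deriveN _ _ _ f). Qed.

Lemma is_derive_add : is_derive s (1 : K) (fun x => f x + g x) (v + w).
Proof. exact: (@is_deriveD _ _ _ f g). Qed.

Lemma is_derive_sub : is_derive s (1 : K) (fun x => f x - g x) (v - w).
Proof. exact: (@is_deriveB _ _ _ f g). Qed.

Lemma is_derive_scale k : is_derive s (1 : K) (fun x => k *: f x) (k *: v).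
Proof. exact: (@is_deriveZ _ _ _ f). Qed.

End pointwise.

Lemma abs_continuous_entry p q (u : K -> 'M[K]_(p, q)) a b i j :
  abs_continuous a b u -> abs_continuous a b (fun s => u s i j).
Proof.
apply: (@abs_continuous_lip _ _ _ _ _ 1) => x y _ _; rewrite mul1r.
by apply: le_trans (mx_norm_entry _ i j); rewrite !mxE.
Qed.

End matrix_norm.

(** * Mean value estimates from almost everywhere derivative bounds *)

Section comparison.
Variable K : realType.
Notation mu := (@lebesgue_measure K).

Lemma ae_sub (P Q : K -> Prop) : (forall s, P s -> Q s) ->
  {ae mu, forall s, P s} -> {ae mu, forall s, Q s}.
Proof. by move=> PQ; apply: filterS => //; exact: (ae_filter_ringOfSetsType mu). Qed.

Lemma ae_and (P Q : K -> Prop) : {ae mu, forall s, P s} -> {ae mu, forall s, Q s} ->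
  {ae mu, forall s, P s /\ Q s}.
Proof. by move=> aeP aeQ; apply: filterI => //; exact: (ae_filter_ringOfSetsType mu). Qed.

Lemma ac_le (f : K -> K) (a b : K) : a <= b -> abs_continuous a b f ->
  {ae mu, forall s, a < s < b -> exists2 v, is_derive s (1 : K) f v & 0 <= v} ->
  f a <= f b.
Proof.
move=> ab acf aef; apply: ac_nondecreasing => //.
apply: ae_sub aef => s + /=; rewrite in_itv/= => /[apply] -[v [df dv] v0].
by rewrite derive1E dv.
Qed.

(** A mean value inequality, proved entry by entry: [- g] plus or minus an entry of [u] has an
    almost everywhere nonnegative derivative, hence is nondecreasing. *)
Lemma ac_comparison p q (u : K -> 'M[K]_(p, q)) (g g' : K -> K) a b : a <= b ->
  abs_continuous a b u -> abs_continuous a b g ->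
  (forall s, is_derive s (1 : K) g (- g' s)) ->
  {ae mu, forall s, a < s < b -> exists2 v, is_derive s (1 : K) u v & `|v| <= g' s} ->
  `|u a - u b| <= g a - g b.
Proof.
move=> ab acu acg dg aeu.
have acNg : abs_continuous a b (fun s => - g s).
  by apply: (@abs_continuous_lip _ _ _ _ _ 1 g) => // x y _ _; rewrite -opprD normrN mul1r.
apply: mx_norm_le => [|i j].
  (* The matrix may have no entry at all, so the sign of the bound is proved separately, from
     [0 <= |v| <= g']. *)
  rewrite subr_ge0 -lerN2; apply: (ac_le (f := fun s => - g s) ab) => //.
  apply: ae_sub aeu => s /[apply] -[v dv vg].
  exists (g' s); first by rewrite -[g' s]opprK; exact: is_derive_opp.
  exact: le_trans vg.
rewrite !mxE ler_norml; apply/andP; split.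
- suff : - g a - u a i j <= - g b - u b i j by lra.
  apply: (ac_le (f := fun s => - g s - u s i j)) => //.
    by apply: abs_continuousB => //; exact: abs_continuous_entry.
  apply: ae_sub aeu => s /[apply] -[v dv vg].
  exists (g' s - v i j).
    apply: (is_derive_eq (is_derive_sub (is_derive_opp (dg s)) (is_derive_entry i j dv))).
    by rewrite opprK.
  by rewrite subr_ge0 (le_trans _ vg)// (le_trans (ler_norm _))// mx_norm_entry.
- suff : - g a + u a i j <= - g b + u b i j by lra.
  apply: (ac_le (f := fun s => - g s + u s i j)) => //.
    by apply: abs_continuousD => //; exact: abs_continuous_entry.
  apply: ae_sub aeu => s /[apply] -[v dv vg].
  exists (g' s + v i j).
    apply: (is_derive_eq (is_derive_add (is_derive_opp (dg s)) (is_derive_entry i j dv))).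
    by rewrite opprK.
  rewrite -[v i j]opprK subr_ge0 (le_trans _ vg)// (le_trans (ler_norm _))//.
  by rewrite normrN mx_norm_entry.
Qed.

Lemma ac_lipschitz p q (u : K -> 'M[K]_(p, q)) c a b : a <= b ->
  abs_continuous a b u ->
  {ae mu, forall s, a < s < b -> exists2 v, is_derive s (1 : K) u v & `|v| <= c} ->
  `|u a - u b| <= c * (b - a).
Proof.
move=> ab acu aeu.
have -> : c * (b - a) = - c * a - (- c * b) by ring.
apply: (@ac_comparison _ _ u (fun s => - c * s) (fun=> c)) => //.
  exact: (abs_continuousZ (-c) (abs_continuous_id a b)).
by move=> s; apply: (is_derive_eq (is_derive_scale (is_derive_id s 1) (- c))); rewrite scaler1.
Qed.

(** Weight of a Bielecki norm for equations solved backward from T: it equals 1 at T and its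
    derivative is [- k] times itself. *)
Definition expw (k T s : K) : K := expR (k * (T - s)).

Lemma expw_ge1 k T s : 0 <= k -> s <= T -> 1 <= expw k T s.
Proof. by move=> k0 sT; rewrite /expw -expR0 ler_expR mulr_ge0// subr_ge0. Qed.

Lemma expwT k T : expw k T T = 1.
Proof. by rewrite /expw subrr mulr0 expR0. Qed.

Lemma expw_le k T s t : 0 <= k -> s <= t -> expw k T t <= expw k T s.
Proof. by move=> k0 st; rewrite ler_expR ler_wpM2l// lerD2l lerN2. Qed.

Lemma is_derive_expw k T s : is_derive s (1 : K) (expw k T) (- (k * expw k T s)).
Proof.
have d1 := is_derive_scale (is_derive_sub (is_derive_cst T s 1) (is_derive_id s 1)) k.
apply: (is_derive_eq (@is_derive1_comp _ expR (fun x => k *: (cst T x - x)) s _ _ _ d1)).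
by rewrite sub0r /GRing.scale/= mulrN1 mulrN mulrC.
Qed.

Lemma expw_lip k T a x y : 0 <= k -> a <= x -> a <= y ->
  `|expw k T y - expw k T x| <= k * expw k T a * `|y - x|.
Proof.
move=> k0; wlog xy : x y / x <= y => [H ax ay|ax ay].
  have [xy|/ltW yx] := leP x y; first exact: H.
  by rewrite distrC (distrC y); exact: H.
rewrite distrC !ger0_norm ?subr_ge0 ?expw_le//.
have -> : expw k T y = expw k T x * expR (- (k * (y - x))).
  by rewrite /expw -expRD; congr expR; ring.
rewrite -{1}[expw k T x]mulr1 -mulrBr.
have h := expR_ge1Dx (- (k * (y - x))).
have h2 : 1 - expR (- (k * (y - x))) <= k * (y - x) by lra.
apply: (@le_trans _ _ (expw k T x * (k * (y - x)))); first by rewrite ler_wpM2l ?expR_ge0.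
by rewrite mulrA [in leRHS](mulrC k) ler_wpM2r ?subr_ge0// ler_wpM2r// expw_le.
Qed.

Lemma abs_continuous_expw k T a b : 0 <= k -> abs_continuous a b (expw k T).
Proof.
move=> k0; apply: (@lipschitz_abs_continuous _ _ _ _ (k * expw k T a)).
by move=> x y /andP[ax _] /andP[ay _]; exact: expw_lip.
Qed.

(** Integration against the weight gains a factor 1/k. This is what makes the Picard map a
    contraction on the whole of [0,T], whatever T. *)
Lemma ac_expw p q (u : K -> 'M[K]_(p, q)) (k T c a b : K) : a <= b -> 0 <= k ->
  abs_continuous a b u ->
  {ae mu, forall s, a < s < b ->
    exists2 v, is_derive s (1 : K) u v & `|v| <= k * c * expw k T s} ->
  `|u a - u b| <= c * (expw k T a - expw k T b).
Proof.
move=> ab k0 acu aeu; rewrite mulrBr.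
apply: (@ac_comparison _ _ u (fun s => c * expw k T s) (fun s => k * c * expw k T s)) => //.
  by apply: (@abs_continuousZ _ K^o); exact: abs_continuous_expw.
move=> s; apply: (is_derive_eq (is_derive_scale (is_derive_expw k T s) c)).
by rewrite scalerN /GRing.scale/=; congr (- _); ring.
Qed.

Lemma antiderivative (f : K -> K) (a b c : K) : measurable_fun setT f ->
  (forall x, `|f x| <= c) ->
  exists F : K -> K, [/\ forall x y, `|F x - F y| <= c * `|x - y|, F b = 0 &
    {ae mu, forall s, a < s < b -> is_derive s (1 : K) F (f s)}].
Proof.
move=> mf fc; have c0 : 0 <= c by exact: le_trans (fc 0).
(* Cutting [f] off outside [a,b] makes it integrable on the line, so its integral from minus
   infinity is a primitive; subtracting the value at [b] suits a terminal condition. *)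
pose g := f \_ `[a, b].
have gc x : `|g x| <= c by rewrite /g patchE; case: ifP => // _; rewrite normr0.
have intf : mu.-integrable `[a, b] (EFin \o f).
  apply: measurable_bounded_integrable => //.
  - by rewrite /= lebesgue_measure_itv/=; case: ifP => _; rewrite ?ltry.
  - exact: measurable_funTS.
  - exists c; split; first by rewrite num_real.
    by move=> M cM x _; exact: le_trans (fc x) (ltW cM).
have intg : mu.-integrable setT (EFin \o g).
  by rewrite /g -restrict_EFin -integrable_mkcond.
have intgS (A : set K) : measurable A -> mu.-integrable A (EFin \o g).
  by move=> mA; apply: integrableS intg.
have locg : locally_integrable setT g by apply: integrable_locally.
pose F0 x := (\int[mu]_(t in `]-oo, x]) g t)%R.
exists (fun x => F0 x - F0 b); split; last 2 first.
- by rewrite subrr.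
- have := FTC1Ny (fun y => intgS _ (measurable_itv `]-oo, y])) locg.
  apply: ae_sub => s [dF F's] /andP[as_ sb].
  have dF0 : is_derive s (1 : K) F0 (f s).
    apply: DeriveDef; first exact: dF.
    move: F's; rewrite derive1E => ->; rewrite /g patchE mem_set//=.
    by rewrite in_itv/= !ltW.
  rewrite -[f s]subr0; exact: (is_derive_sub dF0 (is_derive_cst _ _ _)).
wlog : / forall x y, x <= y -> `|F0 y - F0 x| <= c * (y - x).
  move=> H; apply: H => x y xy.
  have -> : F0 y - F0 x = (\int[mu]_(t in `]x, y]) g t)%R.
    by apply: Rintegral_itvB; [exact: intgS|by []|rewrite bnd_simp].
  have mitv : measurable (`]x, y]%classic : set K) by [].
  have fin : (mu (`]x, y]%classic : set K) < +oo)%E.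
    by rewrite /= lebesgue_measure_itv/=; case: ifP => _; rewrite ?ltry.
  apply: le_trans (le_normr_Rintegral _ _) _ => //; first exact: intgS.
  apply: (@le_trans _ _ (\int[mu]_(t in `]x, y]) c)%R).
    apply: le_Rintegral => //.
    - by apply: integrable_norm; exact: intgS.
    - apply: measurable_bounded_integrable => //; exists c; split; first by rewrite num_real.
      by move=> M cM z _; rewrite ger0_norm// ltW.
  rewrite Rintegral_cst//= lebesgue_measure_itv/= lte_fin.
  by case: ltP => /= [_|yx]; rewrite ?mulr0 ?mulr_ge0 ?subr_ge0.
move=> H x y; have -> : F0 x - F0 b - (F0 y - F0 b) = F0 x - F0 y by ring.
have [xy|/ltW yx] := leP x y; last by rewrite (ger0_norm (_ : 0 <= x - y)) ?subr_ge0// H.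
by rewrite distrC (distrC x) (ger0_norm (_ : 0 <= y - x)) ?subr_ge0// H.
Qed.

End comparison.

(** * Clamping and geometric limits *)

Section clamp.
Variables (K : realType) (T : K).

(** Projection of the line onto [0,T] (for T >= 0). Composition with it extends functions from [0,T]
    to the line while keeping their continuity, bounds and order properties. *)
Definition clamp (s : K) : K := Num.max 0 (Num.min s T).

Lemma clamp_itv s : 0 <= T -> 0 <= clamp s <= T.
Proof. by move=> T0; rewrite /clamp le_max lexx/= ge_max T0 ge_min lexx orbT. Qed.

Lemma clamp_id s : 0 <= s <= T -> clamp s = s.
Proof. by move=> /andP[s0 sT]; rewrite /clamp min_l// max_r. Qed.

Lemma clamp_clamp s : 0 <= T -> clamp (clamp s) = clamp s.
Proof. by move=> T0; rewrite clamp_id// clamp_itv. Qed.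

Lemma clamp_mono x y : x <= y -> clamp x <= clamp y.
Proof.
move=> xy; rewrite /clamp ge_max le_max lexx/= le_max le_min.
by rewrite ge_min (le_trans _ xy) ?ge_min ?lexx ?orbT//=; case: leP; rewrite ?orbT.
Qed.

Lemma clamp_lip x y : `|clamp x - clamp y| <= `|x - y|.
Proof.
wlog xy : x y / x <= y => [H|].
  have [xy|/ltW yx] := leP x y; first exact: H.
  by rewrite distrC (distrC x); exact: H.
rewrite distrC (distrC x) (ger0_norm (_ : 0 <= y - x)) ?subr_ge0// ler_norml.
rewrite /clamp !maxEle !minEle.
by case: (leP x T) => ?; case: (leP y T) => ?; case: (leP 0 x) => ?; case: (leP 0 y) => ?;
  case: (leP 0 T) => ?; apply/andP; split; lra.
Qed.

End clamp.

Lemma lipschitz_continuous (K : realType) (V W : normedModType K) (f : V -> W) c :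
  (forall x y, `|f x - f y| <= c * `|x - y|) -> continuous f.
Proof.
move=> fc x; apply/cvgrPdist_le => e e0.
have c0 : 0 < `|c| + 1 by rewrite ltr_wpDl.
near=> y; apply: le_trans (fc _ _) _.
apply: (@le_trans _ _ ((`|c| + 1) * `|x - y|)).
  by rewrite ler_wpM2r// (le_trans (ler_norm _))// lerDl.
rewrite mulrC -ler_pdivlMr//; near: y; apply: cvgr_dist_le => //.
by rewrite divr_gt0.
Unshelve. all: by end_near. Qed.

Lemma clamp_continuous (K : realType) (T : K) : continuous (clamp T).
Proof.
by apply: (@lipschitz_continuous K K^o K^o _ 1) => x y; rewrite mul1r clamp_lip.
Qed.

Lemma continuous_curry_comp (K : realType) (V : topologicalType) (F : K -> K -> V) (f g : K -> K) :
  continuous (fun p : K * K => F p.1 p.2) -> continuous f -> continuous g ->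
  continuous (fun s => F (f s) (g s)).
Proof.
move=> cF cf cg s.
exact: (@cvg_comp _ _ _ (fun s => (f s, g s)) (fun p : K * K => F p.1 p.2) _ _ _
  (cvg_pair (cf s) (cg s)) (cF (f s, g s))).
Qed.

(** Continuity in t uniformly in s and a Lipschitz bound in s combine through the intermediate value
    [P t (clamp T s')]. *)
Lemma clamp_joint_continuous (K : realType) (V : normedModType K) (P : K -> K -> V) (T l : K) :
  0 <= T ->
  (forall t e : K, 0 < e ->
     \forall t' \near t, forall s : K, 0 <= s <= T -> `|P t s - P t' s| <= e) ->
  (forall t s s' : K, 0 <= s <= T -> 0 <= s' <= T -> `|P t s - P t s'| <= l * `|s - s'|) ->
  continuous (fun p : K * K => P p.1 (clamp T p.2)).
Proof.
move=> T0 P_unif P_lip [t s]; apply/cvgrPdist_le => e e0 /=.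
have e2 : 0 < e / 2 by rewrite divr_gt0.
have cl : 0 < `|l| + 1 by rewrite ltr_wpDl.
have e3 : 0 < e / 2 / (`|l| + 1) by rewrite divr_gt0.
have /cvgrPdist_le/(_ _ e3) nears := @cvg_id _ (nbhs s).
exists ([set t' | forall s : K, 0 <= s <= T -> `|P t s - P t' s| <= e / 2],
  [set s' | `|s - s'| <= e / 2 / (`|l| + 1)]).
  by split; [exact: P_unif|exact: nears].
move=> [t' s'] [/= Ht Hs].
rewrite -(subrKA (P t (clamp T s'))) (le_trans (ler_normD _ _))// (splitr e) lerD//; last first.
  exact/Ht/clamp_itv.
rewrite (le_trans (P_lip _ _ _ (clamp_itv _ T0) (clamp_itv _ T0)))//.
apply: (@le_trans _ _ ((`|l| + 1) * `|s - s'|)); last by rewrite mulrC -ler_pdivlMr.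
apply: (@le_trans _ _ ((`|l| + 1) * `|clamp T s - clamp T s'|)).
  by rewrite ler_wpM2r// (le_trans (ler_norm _))// lerDl.
by rewrite ler_wpM2l ?clamp_lip// ltW.
Qed.

Section geometric_limit.
Variable K : realType.

(** The intervals of radius [2 * c / 2 ^+ k] around [u k] are nested, and the supremum of their left
    ends lies in all of them; the rate thus comes together with the limit. *)
Lemma real_geometric_limit (u : nat -> K) c :
  (forall k, `|u k.+1 - u k| <= c / 2 ^+ k) ->
  exists l, forall k, `|u k - l| <= 2 * c / 2 ^+ k.
Proof.
move=> uc.
pose a k := u k - 2 * c / 2 ^+ k; pose b k := u k + 2 * c / 2 ^+ k.
have E k : 2 * c / 2 ^+ k.+1 = c / 2 ^+ k :> K.
  by rewrite exprS; field; rewrite expf_neq0.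
have E' k : 2 * c / 2 ^+ k = c / 2 ^+ k + c / 2 ^+ k :> K by field; rewrite expf_neq0.
have aS : nondecreasing_seq a.
  apply/nondecreasing_seqP => k; have := uc k.
  by rewrite /a E E' ler_norml => /andP[? ?]; lra.
have bS : nonincreasing_seq b.
  apply/nonincreasing_seqP => k; have := uc k.
  by rewrite /b E E' ler_norml => /andP[? ?]; lra.
have c0 k : 0 <= c / 2 ^+ k by exact: le_trans (uc k).
have ab k j : a k <= b j.
  apply: (@le_trans _ _ (a (maxn k j))); first by apply: aS; rewrite leq_maxl.
  apply: (@le_trans _ _ (b (maxn k j))); last by apply: bS; rewrite leq_maxr.
  by rewrite /a /b E'; have := c0 (maxn k j); lra.
have supa : has_sup (range a).
  by split; [exists (a 0%N), 0%N|exists (b 0%N) => _ [k _ <-]].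
exists (sup (range a)) => k.
have h1 : a k <= sup (range a) by apply: (sup_upper_bound supa); exists k.
have h2 : sup (range a) <= b k by apply: ge_sup; [exists (a 0%N), 0%N|move=> _ [j _ <-]].
by rewrite ler_norml; move: h1 h2; rewrite /a /b => *; apply/andP; split; lra.
Qed.

Lemma mx_geometric_limit p q (u : nat -> 'M[K]_(p, q)) c :
  (forall k, `|u k.+1 - u k| <= c / 2 ^+ k) ->
  exists l, forall k, `|u k - l| <= 2 * c / 2 ^+ k.
Proof.
move=> uc.
have /choice[l lP] (ij : 'I_p * 'I_q) : exists l, forall k, `|u k ij.1 ij.2 - l| <= 2 * c / 2 ^+ k.
  apply: (@real_geometric_limit (fun k => u k ij.1 ij.2)) => k; apply: le_trans (uc k).
  by apply: le_trans (mx_norm_entry _ ij.1 ij.2); rewrite !mxE.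
exists (\matrix_(i, j) l (i, j)) => k; apply: mx_norm_le => [|i j].
  have c0 : 0 <= c / 2 ^+ k by exact: le_trans (uc k).
  by rewrite -mulrA mulr_ge0.
by rewrite !mxE; exact: (lP (i, j)).
Qed.

Lemma geometric_eq0 (x c : K) : (forall k, x <= c / 2 ^+ k) -> x <= 0.
Proof.
move=> xc; rewrite leNgt; apply/negP => x0.
have c0 : 0 < c by have := xc 0%N; rewrite expr0 divr1; exact: lt_le_trans.
have := archi_boundP (ltW (divr_gt0 c0 x0)).
set k := Num.bound _ => ck; have := xc k.
rewrite ler_pdivlMr ?exprn_gt0// leNgt => /negP; apply.
rewrite ltr_pdivrMr// mulrC in ck; apply: lt_trans ck _; rewrite ltr_pM2l//.
by rewrite -natrX ltr_nat ltn_expl.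
Qed.

End geometric_limit.

(** * Picard iteration *)

Section picard.
Variables (K : realType) (n : nat) (T : K).
Notation M := 'M[K]_n.
Notation mu := (@lebesgue_measure K).
Variables (h : K -> K -> M -> M -> M) (G : K -> M) (a g : K).
Hypothesis T0 : 0 <= T.
Hypothesis h_measurable : forall t (P p : K -> M), continuous P -> continuous p ->
  forall i j, measurable_fun setT (fun s => h t s (P s) (p s) i j).
Hypothesis a0 : 0 < a.
Hypothesis h_bound : forall (t s : K) (X Y : M), `|h t s X Y| <= a * (1 + `|X|).
Hypothesis h_lip : forall N : K, exists2 L : K, 0 < L & forall (t s : K) (X X' Y Y' : M),
  `|X| <= N -> `|X'| <= N -> `|h t s X Y - h t s X' Y'| <= L * (`|X - X'| + `|Y - Y'|).
Hypothesis h_cont : forall N t e : K, 0 < e -> \forall t' \near t, forall (s : K) (X Y : M),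
  0 <= s <= T -> `|X| <= N -> `|h t s X Y - h t' s X Y| <= e.
Hypothesis G_cont : continuous G.
Hypothesis G_bound : forall t, `|G t| <= g.

(** If [|X| <= C * w] then, as [1 <= C * w], the growth bound gives
    [|h| <= a * (1 + |X|) <= k * (C * w)], so the bound by [C * w] is preserved by integration; the
    [+ 1] in [C] ensures [1 <= C]. [N] bounds [C * w] for nonnegative times, and [c] bounds [h] when
    [|X| <= N]. *)
Let k := 2 * a.
Let C := g + 1.
Let w := expw k T.
Let N := C * w 0.
Let c := a * (1 + N).

(** Set preserved by the Picard map; the first two clauses make the diagonal continuous, hence the
    next integrand measurable. *)
Let adm (P : K -> K -> M) := [/\
  forall t e : K, 0 < e -> \forall t' \near t, forall s : K, 0 <= s <= T -> `|P t s - P t' s| <= e,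
  forall t s s' : K, 0 <= s <= T -> 0 <= s' <= T -> `|P t s - P t s'| <= c * `|s - s'| &
  forall t s : K, 0 <= s <= T -> `|P t s| <= C * w s].

(** [P'] is a Picard iterate of [P]: both the row and the diagonal on the right-hand side are frozen
    at [P], so each row of [P'] is a plain antiderivative. *)
Let sol (P P' : K -> K -> M) := forall t, [/\ P' t T = G t,
  forall s s' : K, `|P' t s - P' t s'| <= c * `|s - s'| &
  {ae mu, forall s, 0 < s < T -> is_derive s (1 : K) (P' t) (- h t s (P t s) (P s s))}].

Let g0 : 0 <= g. Proof. exact: le_trans (G_bound 0). Qed.
Let C1 : 1 <= C. Proof. by rewrite /C lerDr. Qed.
Let k0 : 0 <= k. Proof. by rewrite mulr_ge0 ?(ltW a0). Qed.
Let w1 s : s <= T -> 1 <= w s. Proof. exact: expw_ge1. Qed.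
Let wN s : 0 <= s -> C * w s <= N.
Proof. by move=> s0; rewrite /N ler_wpM2l ?expw_le// (le_trans _ C1). Qed.
Let N1 : 1 <= N.
Proof. by apply: le_trans (wN (lexx 0)); rewrite -[1]mulr1 ler_pM ?w1. Qed.
Let c0 : 0 <= c. Proof. by rewrite mulr_ge0 ?addr_ge0 ?(ltW a0)// (le_trans _ N1). Qed.

Let admN P t s : adm P -> 0 <= s <= T -> `|P t s| <= N.
Proof.
move=> [_ _ X3] sT; apply: le_trans (X3 t s sT) _.
by apply: wN; case/andP: sT.
Qed.

Let clampT s := clamp_itv s T0.

Let adm_row P t : adm P -> continuous (fun s => P t (clamp T s)).
Proof.
move=> [_ X2 _]; apply: (@lipschitz_continuous _ K^o _ _ c) => x y.
by apply: le_trans (X2 _ _ _ (clampT x) (clampT y)) _; rewrite ler_wpM2l// clamp_lip.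
Qed.

Let adm_diag P : adm P -> continuous (fun s => P (clamp T s) (clamp T s)).
Proof.
move=> [X1 X2 _]; have cc := @clamp_continuous K T.
have := continuous_curry_comp (F := fun t s => P t (clamp T s))
  (clamp_joint_continuous T0 X1 X2) cc cc.
by under eq_fun do rewrite clamp_clamp//.
Qed.

Let sol_exists P : adm P -> exists P', sol P P'.
Proof.
move=> admP.
suff /choice[P' P'P] : forall t, exists f : K -> M, [/\ f T = G t,
    forall s s' : K, `|f s - f s'| <= c * `|s - s'| &
    {ae mu, forall s, 0 < s < T -> is_derive s (1 : K) f (- h t s (P t s) (P s s))}].
  by exists P'.
move=> t.
(* Clamping the time in the matrix arguments makes the integrand bounded and measurable on the whole
   line, with the same values on [0,T]. *)
pose f s := - h t s (P t (clamp T s)) (P (clamp T s) (clamp T s)).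
have fc s : `|f s| <= c.
  by rewrite normrN (le_trans (h_bound _ _ _ _))// ler_wpM2l ?(ltW a0)// lerD2l admN.
have mf i j : measurable_fun setT (fun s => f s i j).
  under eq_fun do rewrite mxE.
  by apply: measurableT_comp => //; apply: h_measurable; [exact: adm_row|exact: adm_diag].
have /choice[F FP] (ij : 'I_n * 'I_n) : exists F : K -> K,
    [/\ forall x y, `|F x - F y| <= c * `|x - y|, F T = 0 &
    {ae mu, forall s, 0 < s < T -> is_derive s (1 : K) F (f s ij.1 ij.2)}].
  apply: (@antiderivative _ (fun s => f s ij.1 ij.2) 0 T c) => // x.
  exact: le_trans (mx_norm_entry _ _ _) (fc _).
exists (fun s => G t + \matrix_(i, j) F (i, j) s); split.
- by apply/matrixP => i j; rewrite !mxE; have [_ -> _] := FP (i, j); rewrite addr0.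
- move=> s s'; apply: mx_norm_le => [|i j]; first by rewrite mulr_ge0.
  by rewrite !mxE opprD addrACA subrr add0r; have [] := FP (i, j).
- have : {ae mu, forall s, forall ij : 'I_n * 'I_n, 0 < s < T ->
      is_derive s (1 : K) (F ij) (f s ij.1 ij.2)}.
    have FF := ae_filter_ringOfSetsType mu.
    by apply: (@filter_forall K _ _ _ FF) => ij; have [] := FP ij.
  apply: ae_sub => s H sT; have {}H ij := H ij sT.
  have sT' : 0 <= s <= T by case/andP: sT => *; rewrite !ltW.
  have -> : - h t s (P t s) (P s s) = 0 + f s by rewrite add0r /f clamp_id.
  have dF : is_derive s (1 : K) (fun s => \matrix_(i, j) F (i, j) s : M) (f s).
    apply: is_derive_mx => i j.
    have -> : (fun s => (\matrix_(i, j) F (i, j) s : M) i j) = F (i, j).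
      by apply/funext => z; rewrite mxE.
    exact: (H (i, j)).
  exact: (is_derive_add (is_derive_cst (G t) s 1) dF).
Qed.

Let sol_ac P P' t x y : sol P P' -> abs_continuous x y (P' t).
Proof.
move=> /(_ t)[_ X2 _]; apply: (@lipschitz_abs_continuous _ _ _ _ c) => u v _ _.
by rewrite X2.
Qed.

Let sol_ae P P' t s : sol P P' -> 0 <= s ->
  {ae mu, forall r, s < r < T -> is_derive r (1 : K) (P' t) (- h t r (P t r) (P r r))}.
Proof.
move=> /(_ t)[_ _ +] s0; apply: ae_sub => r H /andP[sr rT]; apply: H.
by rewrite (le_lt_trans s0 sr).
Qed.

Let itvW s r : 0 <= s -> s < r < T -> 0 <= r <= T.
Proof. by move=> s0 /andP[sr rT]; rewrite (ltW rT) (le_trans s0 (ltW sr)). Qed.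

Let sol_adm P P' : adm P -> sol P P' -> adm P'.
Proof.
move=> admP solP; have [X1 X2 X3] := admP; split.
- move=> t e e0.
  have [L L0 hL] := h_lip N.
  (* The derivative of the difference of two rows is at most [(1 + L) * e1]; over a length at most T
     this integrates to less than [e / 2], and the other half is spent on [G]. *)
  pose e1 := e / (2 * (1 + L) * (T + 1)).
  have T1 : 0 < T + 1 by rewrite ltr_wpDl.
  have e10 : 0 < e1 by rewrite divr_gt0// !mulr_gt0//; lra.
  have nh := h_cont N t e10; have nP := X1 t e1 e10.
  have e2 : 0 < e / 2 by rewrite divr_gt0.
  have /cvgrPdist_le/(_ _ e2) nG := @G_cont t.
  near=> t' => s sT; have [s0 sT'] := andP sT.
  have hh : forall (s : K) (X Y : M), 0 <= s <= T -> `|X| <= N -> `|h t s X Y - h t' s X Y| <= e1.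
    by near: t'.
  have hP : forall s, 0 <= s <= T -> `|P t s - P t' s| <= e1 by near: t'.
  have hG : `|G t - G t'| <= e / 2 by near: t'.
  have H : `|(P' t s - P' t' s) - (P' t T - P' t' T)| <= (1 + L) * e1 * (T - s).
    apply: (@ac_lipschitz _ _ _ (fun s => P' t s - P' t' s)) => //.
      by apply: abs_continuousB; exact: sol_ac solP.
    apply: ae_sub (ae_and (sol_ae t solP s0) (sol_ae t' solP s0)) => r [H1 H2] sr.
    have rT := itvW s0 sr.
    exists (- h t r (P t r) (P r r) - - h t' r (P t' r) (P r r)).
      by apply: is_derive_sub; [exact: H1|exact: H2].
    rewrite opprK addrC distrC.
    (* Both rows share the diagonal argument [P r r], so only the change of t in [h] and the change
       of row contribute. *)
    rewrite (_ : _ - _ = (h t r (P t r) (P r r) - h t' r (P t r) (P r r)) +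
      (h t' r (P t r) (P r r) - h t' r (P t' r) (P r r))); last by rewrite addrA subrK.
    rewrite (le_trans (ler_normD _ _))// mulrDl mul1r lerD//; first by rewrite hh// admN.
    apply: le_trans (hL _ _ _ _ _ _ _ _) _; rewrite ?admN//.
    by rewrite subrr normr0 addr0 ler_wpM2l ?(ltW L0)// hP.
  have [E' _ _] := solP t'.
  move: H; have [-> _ _] := solP t; rewrite E' => H.
  rewrite -[P' t s - _](subrK (G t - G t')) (le_trans (ler_normD _ _))// (splitr e) lerD//.
  apply: le_trans H _; rewrite /e1.
  have -> : (1 + L) * (e / (2 * (1 + L) * (T + 1))) * (T - s) = (e / 2) * ((T - s) / (T + 1)).
    by field; apply/andP; split; apply: lt0r_neq0; lra.
  rewrite ler_piMr ?(ltW e2)// ler_pdivrMr; lra.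
- by move=> t s s' _ _; have [] := solP t.
- move=> t s sT; have [s0 sT'] := andP sT.
  have H : `|P' t s - P' t T| <= C * (w s - w T).
    apply: (@ac_expw _ _ _ (P' t) k T) => //; first exact: sol_ac solP.
    apply: ae_sub (sol_ae t solP s0) => r H sr; have rT := itvW s0 sr.
    exists (- h t r (P t r) (P r r)); first exact: H.
    rewrite normrN (le_trans (h_bound _ _ _ _))// /k -mulrA -mulrA mulrCA ler_wpM2l ?(ltW a0)//.
    have := X3 t r rT; have [_ /w1 w1r] := andP rT.
    have : 1 <= C * w r by rewrite -[1]mulr1 ler_pM.
    by rewrite mulrDl mul1r; lra.
  move: H; have [-> _ _] := solP t; rewrite /w expwT mulrBr mulr1 -/w => H.
  rewrite -[P' t s](subrK (G t)) (le_trans (ler_normD _ _))//.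
  by have := G_bound t; rewrite /C in H *; lra.
Unshelve. all: by end_near. Qed.

(** Row and diagonal arguments contribute [2 * L * m] times the weight; integrating against a weight
    of rate [4 * L] divides by [4 * L], which leaves [m / 2]. *)
Let contraction (L m : K) P Q P' Q' : 0 < L ->
  (forall (t s : K) (X X' Y Y' : M), `|X| <= N -> `|X'| <= N ->
     `|h t s X Y - h t s X' Y'| <= L * (`|X - X'| + `|Y - Y'|)) ->
  adm P -> adm Q -> sol P P' -> sol Q Q' -> 0 <= m ->
  (forall t s : K, 0 <= s <= T -> `|P t s - Q t s| <= m * expw (4 * L) T s) ->
  forall t s : K, 0 <= s <= T -> `|P' t s - Q' t s| <= m / 2 * expw (4 * L) T s.
Proof.
move=> L0 hL aP aQ sP sQ m0 PQ t s sT; have [s0 sT'] := andP sT.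
have H : `|(P' t s - Q' t s) - (P' t T - Q' t T)| <=
    m / 2 * (expw (4 * L) T s - expw (4 * L) T T).
  apply: (@ac_expw _ _ _ (fun s => P' t s - Q' t s) (4 * L) T) => //.
  - by rewrite mulr_ge0 ?(ltW L0).
  - by apply: abs_continuousB; [exact: sol_ac sP|exact: sol_ac sQ].
  apply: ae_sub (ae_and (sol_ae t sP s0) (sol_ae t sQ s0)) => r [H1 H2] sr.
  have rT := itvW s0 sr.
  exists (- h t r (P t r) (P r r) - - h t r (Q t r) (Q r r)).
    by apply: is_derive_sub; [exact: H1|exact: H2].
  rewrite opprK addrC distrC (le_trans (hL _ _ _ _ _ _ _ _))// ?admN//.
  have := lerD (PQ t r rT) (PQ r r rT); rewrite -(ler_pM2l L0) => /le_trans; apply.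
  by rewrite le_eqVlt; apply/orP; left; apply/eqP; field.
move: H; have [-> _ _] := sP t; have [-> _ _] := sQ t; rewrite subrr subr0 => /le_trans; apply.
by rewrite ler_wpM2l ?divr_ge0// expwT gerBl.
Qed.

Theorem picard : exists P : K -> K -> M, [/\
  forall t e : K, 0 < e -> \forall t' \near t, forall s : K, 0 <= s <= T -> `|P t s - P t' s| <= e,
  exists2 c, 0 <= c & forall t s s' : K, `|P t s - P t s'| <= c * `|s - s'|,
  exists N, forall t s : K, 0 <= s <= T -> `|P t s| <= N,
  forall t, P t T = G t &
  forall t, {ae mu, forall s, 0 < s < T -> is_derive s (1 : K) (P t) (- h t s (P t s) (P s s))}].
Proof.
(* The Picard map, obtained by choice; its value outside the admissible set is unspecified. *)
have /choice[Phi PhiP] (P : K -> K -> M) : exists P', adm P -> sol P P'.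
  have [/sol_exists[P' P'P]|nP] := pselect (adm P); first by exists P'.
  by exists P.
have Phi_adm P : adm P -> adm (Phi P) by move=> aP; exact: sol_adm aP (PhiP P aP).
pose P0 (t s : K) := G t; pose Pk j := iter j Phi P0.
have admk j : adm (Pk j).
  elim: j => [|j /Phi_adm//]; split=> [t e e0|t s s' _ _|t s /andP[_ sT]].
  - have /cvgrPdist_le/(_ _ e0) := @G_cont t.
    by apply: filterS => t' H s _.
  - by rewrite subrr normr0 mulr_ge0.
  - apply: (le_trans (G_bound t)); have := w1 sT; rewrite /C.
    by move=> ws; rewrite -[leLHS]mulr1 ler_pM//; lra.
have [L L0 hL] := h_lip N.
pose w2 := expw (4 * L) T; pose m := 2 * N.
have L4 : 0 <= 4 * L by rewrite mulr_ge0 ?(ltW L0).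
have m0 : 0 <= m by rewrite /m; have := N1; lra.
have Pk_dist j t s : 0 <= s <= T -> `|Pk j.+1 t s - Pk j t s| <= m / 2 ^+ j * w2 s.
  elim: j t s => [t s sT|j IH t s sT].
    rewrite expr0 divr1 (@le_trans _ _ m)//.
      rewrite (le_trans (ler_normB _ _))// /m mulr_natl mulr2n.
      by apply: lerD; apply: admN.
    by rewrite -[leLHS]mulr1 ler_wpM2l// expw_ge1//; case/andP: sT.
  rewrite exprS invfM (mulrC 2^-1) mulrA.
  apply: (@contraction L _ (Pk j.+1) (Pk j)) => //; try exact: PhiP.
  by rewrite divr_ge0// exprn_ge0.
pose m' := m * w2 0.
have Pk_dist' j t s : 0 <= s <= T -> `|Pk j.+1 t s - Pk j t s| <= m' / 2 ^+ j.
  move=> sT; apply: le_trans (Pk_dist _ _ _ sT) _.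
  rewrite /m' mulrAC ler_wpM2r ?invr_ge0 ?exprn_ge0// ler_wpM2l// expw_le//.
  by case/andP: sT.
have /choice[Pinf PinfP] (ts : K * K) : exists l, 0 <= ts.2 <= T ->
    forall j, `|Pk j ts.1 ts.2 - l| <= 2 * m' / 2 ^+ j.
  have [sT|] := boolP (0 <= ts.2 <= T); last by exists 0.
  have [l lP] := mx_geometric_limit (fun j => Pk_dist' j ts.1 ts.2 sT).
  by exists l.
pose P t s := Pinf (t, s).
have PP t s j : 0 <= s <= T -> `|Pk j t s - P t s| <= 2 * m' / 2 ^+ j.
  by move=> sT; exact: (PinfP (t, s)).
have to0 (x y d : K) : (forall j, x <= y + d / 2 ^+ j) -> x <= y.
  by move=> H; rewrite -subr_le0; apply: (@geometric_eq0 _ _ d) => j; rewrite lerBlDl.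
have m'0 : 0 <= m' by rewrite mulr_ge0// expR_ge0.
have admP : adm P.
  split=> [t e e0|t s s' sT s'T|t s sT].
  - have e2 : 0 < e / 2 by rewrite divr_gt0.
    have [j jP] : exists j, 4 * m' / 2 ^+ j <= e / 2.
      apply: contrapT => H; suff : e / 2 <= 0 by lra.
      apply: (@geometric_eq0 _ _ (4 * m')) => j; apply: ltW; rewrite ltNge.
      by apply/negP => ?; apply: H; exists j.
    have [X1 _ _] := admk j.
    apply: filterS (X1 t _ e2) => t' H s sT.
    have := H s sT; have := PP t s j sT; have := PP t' s j sT => h1 h2 h3.
    rewrite (_ : _ - _ = - (Pk j t s - P t s) + (Pk j t s - Pk j t' s) + (Pk j t' s - P t' s)).
      rewrite (le_trans (ler_normD _ _))// (le_trans (lerD (ler_normD _ _) (lexx _)))//.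
      rewrite normrN; have E : 4 * m' / 2 ^+ j = 2 * m' / 2 ^+ j + 2 * m' / 2 ^+ j.
        by rewrite -mulrDl; congr (_ / _); ring.
      by lra.
    by rewrite opprB [X in _ = X + _]addrA subrK addrA subrK.
  - apply: (to0 _ _ (4 * m')) => j; have [_ X2 _] := admk j.
    have := X2 t s s' sT s'T; have := PP t s j sT; have := PP t s' j s'T => h1 h2 h3.
    rewrite (_ : _ - _ = - (Pk j t s - P t s) + (Pk j t s - Pk j t s') + (Pk j t s' - P t s')).
      rewrite (le_trans (ler_normD _ _))// (le_trans (lerD (ler_normD _ _) (lexx _)))//.
      rewrite normrN; have E : 4 * m' / 2 ^+ j = 2 * m' / 2 ^+ j + 2 * m' / 2 ^+ j.
        by rewrite -mulrDl; congr (_ / _); ring.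
      by lra.
    by rewrite opprB [X in _ = X + _]addrA subrK addrA subrK.
  - apply: (to0 _ _ (2 * m')) => j; have [_ _ X3] := admk j.
    rewrite -[P t s](subrK (Pk j t s)) addrC (le_trans (ler_normD _ _))// lerD// ?X3//.
    by rewrite distrC PP.
(* Fixed point: by contraction [Phi P] is close to [Pk j.+1], which is close to [P]. *)
have PhiE t s : 0 <= s <= T -> Phi P t s = P t s.
  move=> sT; apply/eqP; rewrite -subr_eq0 -normr_le0.
  apply: (@geometric_eq0 _ _ (2 * m' * w2 0)) => j.
  have H : `|Phi P t s - Pk j.+1 t s| <= (2 * m' / 2 ^+ j) / 2 * w2 s.
    apply: (@contraction L _ P (Pk j)) => //; try exact: PhiP.
      by rewrite divr_ge0 ?exprn_ge0// mulr_ge0.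
    move=> t1 s1 s1T; rewrite distrC (le_trans (PP _ _ j s1T))//.
    rewrite -[leLHS]mulr1 ler_wpM2l ?expw_ge1//; first by rewrite divr_ge0 ?exprn_ge0// mulr_ge0.
    by case/andP: s1T.
  have {}H : `|Phi P t s - Pk j.+1 t s| <= m' / 2 ^+ j * w2 0.
    apply: le_trans H _; rewrite (_ : 2 * m' / 2 ^+ j / 2 = m' / 2 ^+ j); last first.
      by field; rewrite expf_neq0.
    rewrite ler_wpM2l ?divr_ge0 ?exprn_ge0// expw_le//; by case/andP: sT.
  have H2 : `|Pk j.+1 t s - P t s| <= m' / 2 ^+ j * w2 0.
    apply: le_trans (PP _ _ _ sT) _; rewrite exprS (_ : 2 * m' / (2 * 2 ^+ j) = m' / 2 ^+ j).
      by rewrite -[leLHS]mulr1 ler_wpM2l ?divr_ge0 ?exprn_ge0// expw_ge1.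
    by field; rewrite expf_neq0.
  rewrite -[Phi P t s - _](subrKA (Pk j.+1 t s)) (le_trans (ler_normD _ _))//.
  have -> : 2 * m' * w2 0 / 2 ^+ j = m' / 2 ^+ j * w2 0 + m' / 2 ^+ j * w2 0.
    by field; rewrite expf_neq0.
  by rewrite lerD.
have solP := PhiP _ admP; have [X1 _ _] := Phi_adm _ admP.
(* The witness is [Phi P] and not the limit [P], whose values off [0,T] are arbitrary: the Lipschitz
   bound is claimed for all times. *)
exists (Phi P); split => //.
- by exists c => // t s s'; have [_] := solP t.
- by exists N => t s sT; apply: admN => //; exact: Phi_adm.
- by move=> t; have [] := solP t.
- move=> t; have [_ _] := solP t; apply: ae_sub => s H /[dup] /H {}H /andP[s0 sT].
  by rewrite !PhiE// !ltW.
Qed.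

End picard.

(** * Quadratic forms *)

Section bilinear_form.
Variable K : realType.

Definition bf p q (M : 'M[K]_(p, q)) (x : 'cV[K]_p) (y : 'cV[K]_q) : K :=
  (x^T *m M *m y) 0 0.

Definition sq p (x : 'cV[K]_p) : K := (x^T *m x) 0 0.

Section rect.
Variables p q : nat.
Implicit Types (M N : 'M[K]_(p, q)) (x : 'cV[K]_p) (y : 'cV[K]_q).

Lemma bfD M N x y : bf (M + N) x y = bf M x y + bf N x y.
Proof. by rewrite /bf mulmxDr mulmxDl mxE. Qed.

Lemma bfN M x y : bf (- M) x y = - bf M x y.
Proof. by rewrite /bf mulmxN mulNmx mxE. Qed.

Lemma bfB M N x y : bf (M - N) x y = bf M x y - bf N x y.
Proof. by rewrite bfD bfN. Qed.

Lemma bfZ a M x y : bf (a *: M) x y = a * bf M x y.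
Proof. by rewrite /bf -scalemxAr -scalemxAl mxE. Qed.

Lemma bfDl M x x' y : bf M (x + x') y = bf M x y + bf M x' y.
Proof. by rewrite /bf linearD/= !mulmxDl mxE. Qed.

Lemma bfDr M x y y' : bf M x (y + y') = bf M x y + bf M x y'.
Proof. by rewrite /bf mulmxDr mxE. Qed.

Lemma bfZl a M x y : bf M (a *: x) y = a * bf M x y.
Proof. by rewrite /bf linearZ/= -!scalemxAl mxE. Qed.

Lemma bfZr a M x y : bf M x (a *: y) = a * bf M x y.
Proof. by rewrite /bf -scalemxAr mxE. Qed.

Lemma bf_tr M x y : bf M^T y x = bf M x y.
Proof.
rewrite /bf; have -> : y^T *m M^T *m x = (x^T *m M *m y)^T by rewrite !trmx_mul trmxK mulmxA.
by rewrite mxE.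
Qed.

Lemma bf_mulr r (M : 'M[K]_(p, r)) (N : 'M[K]_(r, q)) x y :
  bf (M *m N) x y = bf M x (N *m y).
Proof. by rewrite /bf !mulmxA. Qed.

Lemma bf_mull r (M : 'M[K]_(r, q)) (N : 'M[K]_(r, p)) x y :
  bf (N^T *m M) x y = bf M (N *m x) y.
Proof. by rewrite /bf trmx_mul !mulmxA. Qed.

Lemma bf_bound M x y : `|bf M x y| <= q%:R * p%:R * (`|x| * `|M| * `|y|).
Proof.
apply: le_trans (mx_norm_entry _ 0 0) _; apply: le_trans (mx_norm_mulmx _ _) _.
rewrite -[leRHS]mulrA ler_wpM2l// mulrA ler_wpM2r//.
by apply: le_trans (mx_norm_mulmx _ _) _; rewrite mx_norm_trmx.
Qed.

Lemma is_derive_bf (u : K -> 'M[K]_(p, q)) s v x y :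
  is_derive s (1 : K) u v -> is_derive s (1 : K) (fun s => bf (u s) x y) (bf v x y).
Proof.
have E M : bf M x y = \sum_j (\sum_i x i 0 * M i j) * y j 0.
  by rewrite /bf mxE; apply: eq_bigr => j _; rewrite mxE; congr (_ * _);
    apply: eq_bigr => i _; rewrite mxE.
move=> du; under eq_fun do rewrite E; rewrite E.
have dd i j : is_derive s (1 : K) (fun s => (y j 0 * x i 0) *: u s i j) ((y j 0 * x i 0) *: v i j).
  by apply: is_derive_scale; exact: is_derive_entry.
have E2 M : \sum_j (\sum_i x i 0 * M i j) * y j 0 = \sum_j \sum_i (y j 0 * x i 0) *: M i j :> K.
  by apply: eq_bigr => j _; rewrite mulr_suml; apply: eq_bigr => i _; rewrite /GRing.scale/=; ring.
under eq_fun do rewrite E2; rewrite E2.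
have F (I : Type) (r : seq I) (f : I -> K -> K) (f' : I -> K) :
    (forall i, is_derive s (1 : K) (f i) (f' i)) ->
    is_derive s (1 : K) (fun s => \sum_(i <- r) f i s) (\sum_(i <- r) f' i).
  move=> df; elim: r => [|i r IH].
    rewrite big_nil; under eq_fun do rewrite big_nil.
    exact: is_derive_cst.
  by rewrite big_cons; under eq_fun do rewrite big_cons; exact: is_derive_add.
by apply: F => j; apply: F => i.
Qed.

Lemma abs_continuous_bf (u : K -> 'M[K]_(p, q)) a b x y :
  abs_continuous a b u -> abs_continuous a b (fun s => bf (u s) x y).
Proof.
apply: (@abs_continuous_lip _ _ _ _ _ (q%:R * p%:R * (`|x| * `|y|))) => r s _ _.
by rewrite -bfB (le_trans (bf_bound _ _ _))// -!mulrA (mulrC `|y|).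
Qed.

End rect.

Section square.
Variable n : nat.
Implicit Types (M N : 'M[K]_n) (x y : 'cV[K]_n).

Lemma sqE x : sq x = \sum_i x i 0 ^+ 2.
Proof. by rewrite /sq mxE; apply: eq_bigr => i _; rewrite mxE expr2. Qed.

Lemma sq_ge0 x : 0 <= sq x.
Proof. by rewrite sqE sumr_ge0// => i _; exact: sqr_ge0. Qed.

Lemma sq_entry x i : x i 0 ^+ 2 <= sq x.
Proof. by rewrite sqE (bigD1 i)//= lerDl sumr_ge0// => j _; exact: sqr_ge0. Qed.

Lemma sq_gt0 x : x != 0 -> 0 < sq x.
Proof.
move=> x0; rewrite lt_neqAle sq_ge0 andbT; apply: contra x0 => /eqP s0.
apply/eqP/matrixP => i j; rewrite mxE ord1; apply/eqP; rewrite -sqrf_eq0 eq_le sqr_ge0 andbT.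
by rewrite s0 sq_entry.
Qed.

Lemma mx_norm_sq x : `|x| ^+ 2 <= sq x.
Proof.
rewrite -[leRHS]sqr_sqrtr ?sq_ge0// ler_sqr ?nnegrE ?sqrtr_ge0//.
apply: mx_norm_le => [|i j]; first exact: sqrtr_ge0.
by rewrite ord1 -sqrtr_sqr ler_wsqrtr// sq_entry.
Qed.

Lemma bf_scalar a x y : bf a%:M x y = a * (x^T *m y) 0 0.
Proof. by rewrite /bf mul_mx_scalar -scalemxAl mxE. Qed.

Lemma bf_scalar_sq a x : bf a%:M x x = a * sq x.
Proof. exact: bf_scalar. Qed.

Lemma sq_mulmx p (C : 'M[K]_(p, n)) x : sq (C *m x) = bf (C^T *m C) x x.
Proof. by rewrite /sq /bf trmx_mul !mulmxA. Qed.

Lemma bf_le_sq M x : `|bf M x x| <= n%:R * n%:R * `|M| * sq x.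
Proof.
apply: le_trans (bf_bound _ _ _) _; rewrite -[leRHS]mulrA ler_wpM2l ?mulr_ge0//.
by rewrite mulrAC mulrC ler_wpM2l// -expr2 mx_norm_sq.
Qed.

Lemma bf_sym M x y : symm M -> bf M x y = bf M y x.
Proof. by move=> sM; rewrite -bf_tr sM. Qed.

Lemma bf_delta M i j : bf M (delta_mx i 0) (delta_mx j 0) = M i j.
Proof. by rewrite /bf trmx_delta -rowE -colE !mxE. Qed.

Lemma psd_ge0 M x : psd M -> 0 <= bf M x x.
Proof. by case=> _; apply. Qed.

Lemma psdD M N : psd M -> psd N -> psd (M + N).
Proof.
move=> [sM M0] [sN N0]; split; first by rewrite /symm linearD/= sM sN.
by move=> x; rewrite -[leRHS]/(bf (M + N) x x) bfD addr_ge0//; [exact: M0|exact: N0].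
Qed.

Lemma psd_congr p (C : 'M[K]_(n, p)) M : psd M -> psd (C^T *m M *m C).
Proof.
move=> [sM M0]; split; first by rewrite /symm !trmx_mul trmxK sM mulmxA.
by move=> x; rewrite -[leRHS]/(bf _ x x) -mulmxA bf_mull bf_mulr; exact: M0.
Qed.

Lemma psd_CauchySchwarz M x y : psd M -> bf M x y ^+ 2 <= bf M x x * bf M y y.
Proof.
move=> psdM; have [sM _] := psdM.
have H t : 0 <= bf M x x + 2 * t * bf M x y + t ^+ 2 * bf M y y.
  have := psd_ge0 (x + t *: y) psdM.
  by rewrite bfDl !bfDr !bfZl !bfZr (bf_sym y x sM) => /le_trans; apply;
    rewrite le_eqVlt; apply/orP; left; apply/eqP; ring.
have := psd_ge0 y psdM; rewrite le_eqVlt => /predU1P[y0|y0].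
  rewrite -y0 mulr0; have [->|b0] := eqVneq (bf M x y) 0; first by rewrite expr0n.
  (* Here the form is affine in t, and this t would give it the value -1. *)
  have := H (- (bf M x x + 1) / (2 * bf M x y)); rewrite -y0 mulr0 addr0.
  have -> : 2 * (- (bf M x x + 1) / (2 * bf M x y)) * bf M x y = - (bf M x x + 1) by field.
  by lra.
have := H (- bf M x y / bf M y y); rewrite -(pmulr_lge0 _ y0) => /le_trans.
have yn : bf M y y != 0 by rewrite gt_eqF.
rewrite -subr_ge0; suff -> : (bf M x x + 2 * (- bf M x y / bf M y y) * bf M x y +
   (- bf M x y / bf M y y) ^+ 2 * bf M y y) * bf M y y = bf M x x * bf M y y - bf M x y ^+ 2.
  by apply.
by field.
Qed.

Lemma psd_ker M x : psd M -> bf M x x = 0 -> M *m x = 0.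
Proof.
move=> psdM x0; apply/matrixP => i j; rewrite ord1 [RHS]mxE.
have := psd_CauchySchwarz (delta_mx i 0) x psdM.
rewrite x0 mulr0 => /(conj (sqr_ge0 _))/andP/le_anti/esym/eqP; rewrite sqrf_eq0 => /eqP.
by rewrite /bf trmx_delta -mulmxA -rowE mxE.
Qed.

Lemma psd_not_posdef M : psd M -> ~ posdef M -> exists2 x : 'cV[K]_n, x != 0 & M *m x = 0.
Proof.
move=> psdM npM; apply: contrapT => H; apply: npM; split; first by case: psdM.
move=> x x0; rewrite lt_neqAle psdM.2 andbT; apply/negP => /eqP xM.
by apply: H; exists x => //; apply: psd_ker.
Qed.

Lemma posdef_psd M : posdef M -> psd M.
Proof.
move=> [sM M0]; split=> // x; have [->|x0] := eqVneq x 0; first by rewrite mulmx0 mxE.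
exact/ltW/M0.
Qed.

Lemma posdef_unitmx M : posdef M -> M \in unitmx.
Proof.
move=> [_ M0]; rewrite unitmxE unitfE; apply/negP => /det0P[v v0 vM].
have := M0 v^T; rewrite trmxK vM mul0mx mxE ltxx => H.
suff : false by []. apply: H; apply: contra v0 => /eqP v0.
by rewrite -[v]trmxK v0 trmx0.
Qed.

(** Neither eigenvalues nor compactness: Cauchy-Schwarz for [M] between x and M^-1 x gives |x|^4 <=
    (x^T M x)(x^T M^-1 x), and the last factor is at most [b] |x|^2. *)
Lemma posdef_coercive M : posdef M -> exists2 c, 0 < c & forall x, c * sq x <= bf M x x.
Proof.
move=> pM; have psdM := posdef_psd pM; have uM := posdef_unitmx pM.
pose b : K := n%:R * n%:R * `|invmx M| + 1.
have b0 : 0 < b by rewrite ltr_wpDl// !mulr_ge0.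
exists b^-1; first by rewrite invr_gt0.
move=> x; have [->|x0] := eqVneq x 0.
  by rewrite /sq /bf !mulmx0 mxE mulr0.
rewrite mulrC ler_pdivrMr//.
have := psd_CauchySchwarz x (invmx M *m x) psdM.
rewrite -bf_mulr mulmxV// bf_scalar_sq mul1r -bf_mulr mulmxV// bf_scalar mul1r.
rewrite trmx_mul -/(bf _ x x) -[X in _ <= _ * X -> _]/(bf (invmx M)^T x x) bf_tr => H.
have := le_trans H (ler_wpM2l (psd_ge0 x psdM) (le_trans (ler_norm _) (bf_le_sq (invmx M) x))).
rewrite mulrA expr2 ler_pM2r ?sq_gt0// => /le_trans; apply.
by rewrite ler_wpM2l ?(psd_ge0 _ psdM)// lerDl.
Qed.

End square.

End bilinear_form.

(** * Positivity of Lyapunov equations *)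

Section positivity.
Variables (K : realType) (n : nat).
Notation M := 'M[K]_n.
Notation mu := (@lebesgue_measure K).
Implicit Types (x : 'cV[K]_n) (s : K).

Definition cont_on (V : normedModType K) (a b : K) (f : K -> V) :=
  forall s e : K, a <= s <= b -> 0 < e -> exists2 r : K, 0 < r &
    forall s', a <= s' <= b -> `|s' - s| < r -> `|f s' - f s| <= e.

Lemma abs_continuous_cont_on (V : normedModType K) (a b : K) (f : K -> V) :
  abs_continuous a b f -> cont_on a b f.
Proof.
move=> acf s e sab e0; have [d d0 H] := acf e e0; exists d => // s' s'ab ss'.
wlog ls : s s' sab s'ab ss' / s <= s' => [W|].
  have [ls|/ltW ls] := leP s s'; first exact: W.
  by rewrite distrC; apply: W => //; rewrite distrC.
have := H 1%N (fun=> s) (fun=> s'); rewrite !big_ord_recl !big_ord0 !addr0 => H1.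
apply/ltW/H1.
- by move=> _; case/andP: sab => ? ?; case/andP: s'ab => ? ?.
- by move=> i j _ _ _; rewrite !ord1.
- by rewrite -[ltLHS]ger0_norm// subr_ge0.
Qed.

(** First contact going backward from [b]. At the last point [s0] where positivity fails, [Y s0] is
    semidefinite with a kernel vector [x]. The barrier [phi] dominates the form of [Y] along [x],
    vanishes at [s0] and does not increase just after it, against positivity there. Only [phi] is
    differentiated, so [Y] may be built on the diagonal of [P]. *)
Lemma posdef_barrier (Y : K -> M) (a b : K) : a <= b ->
  (forall s, a <= s <= b -> symm (Y s)) -> cont_on a b Y -> posdef (Y b) ->
  (forall s0 x, a <= s0 -> s0 < b -> (forall s, s0 < s <= b -> posdef (Y s)) ->
     Y s0 *m x = 0 -> x != 0 ->
     exists phi : K -> K, [/\ abs_continuous s0 b phi, phi s0 = 0,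
       forall s, s0 < s <= b -> bf (Y s) x x <= phi s &
       exists2 r : K, 0 < r & {ae mu, forall s, s0 < s < b -> s < s0 + r ->
         exists2 v, is_derive s (1 : K) phi v & v <= 0}]) ->
  forall s, a <= s <= b -> posdef (Y s).
Proof.
move=> ab Ysym Yc Yb H.
have n2 : 0 <= n%:R * n%:R :> K by rewrite mulr_ge0.
have near_form s s' e x : `|Y s' - Y s| <= e ->
    `|bf (Y s') x x - bf (Y s) x x| <= n%:R * n%:R * e * sq x.
  move=> Ye; rewrite -bfB (le_trans (bf_le_sq _ _))// ler_wpM2r ?sq_ge0//.
  by rewrite ler_wpM2l.
apply: (@real_induction_backward _ (fun s => forall s', s <= s' <= b -> posdef (Y s')) a b) => //.
  by move=> s' /le_anti <-.
move=> s sab; have [as_ sb] := andP sab.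
(* If [Y s] is positive definite, half of its coercivity constant absorbs the variation of [Y] near
   [s]. *)
have [pY|npY] := pselect (posdef (Y s)).
  have [c c0 cP] := posdef_coercive pY.
  have d0 : 0 < n%:R * n%:R + 1 :> K by rewrite ltr_wpDl.
  have e0 : 0 < c / 2 / (n%:R * n%:R + 1) by rewrite !divr_gt0.
  have [r r0 rP] := Yc s _ sab e0.
  exists r => // x y ax sx xs sy ys yb Py s' /andP[xs' s'b].
  have [ys'|s'y] := leP y s'; first by apply: Py; rewrite ys'.
  have s'ab : a <= s' <= b by rewrite s'b (le_trans ax xs').
  split; first exact: Ysym.
  move=> z z0; have := rP s' s'ab; have -> : `|s' - s| < r.
    by rewrite ltr_norml; apply/andP; split; lra.
  move=> /(_ isT)/(@near_form _ _ _ z); rewrite ler_norml => /andP[+ _].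
  have := cP z; have := sq_gt0 z0 => sz.
  have : n%:R * n%:R * (c / 2 / (n%:R * n%:R + 1)) * sq z <= c / 2 * sq z.
    rewrite ler_wpM2r ?sq_ge0// mulrCA ler_piMr//; first by rewrite divr_ge0// ltW.
    by rewrite ler_pdivrMr// mul1r lerDl.
  have : 0 < c / 2 * sq z by rewrite mulr_gt0// divr_gt0.
  have -> : c * sq z = c / 2 * sq z + c / 2 * sq z by field.
  rewrite -/(bf (Y s') z z); lra.
have lsb : s < b by rewrite lt_neqAle sb andbT; apply/negP => /eqP E; apply: npY; rewrite E.
(* Either positivity already fails at some [s' > s], and then the induction hypothesis is false for
   every [y < s']; or [s] is the last failure, and the barrier yields a contradiction. *)
have [allpos|] := pselect (forall s', s < s' <= b -> posdef (Y s')); last first.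
  move=> /existsNP[s' /not_implyP[/andP[ss' s'b] nps']].
  exists (s' - s); first by rewrite subr_gt0.
  move=> x y _ _ _ sy ys _ Py; exfalso; apply/nps'/Py; rewrite s'b andbT ltW//.
  by move: ys; rewrite addrC subrK.
exfalso.
(* A limit from the right: a negative value of the form at [s] would persist at some [s' > s]. *)
have psdY : psd (Y s).
  split; first exact: Ysym.
  move=> x; rewrite -[leRHS]/(bf (Y s) x x) leNgt; apply/negP => neg.
  have e0 : 0 < - bf (Y s) x x / (n%:R * n%:R + 1) / (sq x + 1).
    by rewrite !divr_gt0 ?oppr_gt0//; rewrite ltr_wpDl ?sq_ge0.
  have [r r0 rP] := Yc s _ sab e0.
  pose s' := Num.min b (s + r / 2).
  have ss' : s < s' by rewrite /s' lt_min lsb ltrDl divr_gt0.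
  have s'b : s' <= b by rewrite /s' ge_min lexx.
  have s'r : s' <= s + r / 2 by rewrite /s' ge_min lexx orbT.
  have := rP s'; rewrite s'b (le_trans as_ (ltW ss')) ger0_norm ?subr_ge0 ?(ltW ss')//.
  move=> /(_ isT); have -> : s' - s < r by lra.
  move=> /(_ isT)/(@near_form _ _ _ x); rewrite ler_norml => /andP[_].
  have : n%:R * n%:R * (- bf (Y s) x x / (n%:R * n%:R + 1) / (sq x + 1)) * sq x <= - bf (Y s) x x.
    have -> : n%:R * n%:R * (- bf (Y s) x x / (n%:R * n%:R + 1) / (sq x + 1)) * sq x =
      - bf (Y s) x x * ((n%:R * n%:R / (n%:R * n%:R + 1)) * (sq x / (sq x + 1))) by ring.
    rewrite ler_piMr//; first by rewrite oppr_ge0 ltW.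
    rewrite mulr_ile1 ?divr_ge0 ?addr_ge0 ?sq_ge0//.
      by rewrite ler_pdivrMr ?ltr_wpDl// mul1r lerDl.
    by rewrite ler_pdivrMr ?ltr_wpDl ?sq_ge0// mul1r lerDl.
  have x0 : x != 0 by apply/eqP => x0; move: neg; rewrite x0 /bf mulmx0 mxE ltxx.
  have : 0 < bf (Y s') x x by apply: (allpos s' _).2 => //; rewrite ss'.
  lra.
have [x x0 Yx] := psd_not_posdef psdY npY.
have [phi [acp p0 Yp [r r0 aep]]] := H s x as_ lsb allpos Yx x0.
pose s' := Num.min b (s + r).
have ss' : s < s' by rewrite /s' lt_min lsb ltrDl.
have s'b : s' <= b by rewrite /s' ge_min lexx.
have s'r : s' <= s + r by rewrite /s' ge_min lexx orbT.
have : - phi s <= - phi s'.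
  apply: (ac_le (f := fun s => - phi s)); first exact: ltW.
    apply: (@abs_continuous_lip _ _ _ _ _ 1 phi).
      by move=> y z _ _; rewrite -opprD normrN mul1r.
    exact: abs_continuousS acp.
  apply: ae_sub aep => y Hy /andP[sy ys']; have [||v dv v0] := Hy.
  - by rewrite sy (lt_le_trans ys').
  - exact: lt_le_trans s'r.
  by exists (- v); [exact: is_derive_opp|rewrite oppr_ge0].
have ss'b : s < s' <= b by rewrite ss'.
have : 0 < bf (Y s') x x by apply: (allpos s' ss'b).2.
have := Yp s' ss'b; rewrite p0; lra.
Qed.

Lemma bf_ker (E : M) x y : symm E -> E *m x = 0 -> bf E x y = 0.
Proof. by move=> sE Ex; rewrite bf_sym// /bf -mulmxA Ex mulmx0 mxE. Qed.

(** The terms before the last bound 2 x^T A x + |C x|^2 relative to |x|^2; the final 1 is the strict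
    margin that closes the barrier estimates. *)
Definition growth (c : K) : K := 2 * (n%:R * n%:R * c) + n%:R * n%:R * (n%:R * (c * c)) + 1.

Lemma growth_ge1 c : 0 <= c -> 1 <= growth c.
Proof. by move=> c0; rewrite /growth lerDr addr_ge0 ?mulr_ge0. Qed.

Lemma growthP (A C : M) c x : `|A| <= c -> `|C| <= c ->
  2 * bf A x x + sq (C *m x) <= (growth c - 1) * sq x.
Proof.
move=> Ac Cc; have c0 : 0 <= c by exact: le_trans Ac.
rewrite /growth addrK [leRHS]mulrDl lerD//.
  rewrite -mulrA ler_wpM2l// (le_trans (ler_norm _))// (le_trans (bf_le_sq _ _))//.
  by rewrite ler_wpM2r ?sq_ge0// ler_wpM2l ?mulr_ge0.
rewrite sq_mulmx (le_trans (ler_norm _))// (le_trans (bf_le_sq _ _))//.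
rewrite ler_wpM2r ?sq_ge0// ler_wpM2l ?mulr_ge0// (le_trans (mx_norm_mulmx _ _))//.
by rewrite mx_norm_trmx ler_wpM2l// ler_pM.
Qed.

Lemma bf_mulmx_bound (E A : M) c x : `|A| <= c ->
  `|bf E x (A *m x)| <= n%:R * n%:R * n%:R * c * `|x| * `|x| * `|E|.
Proof.
move=> Ac; have c0 : 0 <= c by exact: le_trans Ac.
apply: le_trans (bf_bound _ _ _) _.
apply: (@le_trans _ _ (n%:R * n%:R * (`|x| * `|E| * (n%:R * (c * `|x|))))).
  rewrite ler_wpM2l ?mulr_ge0// ler_wpM2l ?mulr_ge0// (le_trans (mx_norm_mulmx _ _))//.
  by rewrite ler_wpM2l// ler_wpM2r.
by rewrite le_eqVlt; apply/orP; left; apply/eqP; ring.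
Qed.

(** Lyapunov operator of the linear stochastic system dx = A x ds + C x dW. *)
Definition lyap (X A C : M) : M := X *m A + A^T *m X + C^T *m X *m C.

Lemma bf_lyap (X A C : M) x : symm X ->
  bf (lyap X A C) x x = 2 * bf X x (A *m x) + bf X (C *m x) (C *m x).
Proof.
move=> sX; rewrite /lyap !bfD bf_mulr bf_mull -mulmxA bf_mull bf_mulr (bf_sym _ _ sX).
by ring.
Qed.

Lemma bf_lyapD (X A C N : M) x : symm X ->
  bf (lyap X A C + N) x x = 2 * bf X x (A *m x) + bf X (C *m x) (C *m x) + bf N x x.
Proof. by move=> sX; rewrite bfD bf_lyap. Qed.

(** The perturbation [X + eps * w] I stays positive definite. At a contact vector the terms from [C]
    and [N] have the right sign, the drift term is small because it vanishes at the contact time,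
    and the weight leaves a margin of [eps * w * sq x] to absorb it. Then [eps] tends to 0. *)
Lemma lyapunov_psd (X A C N : K -> M) (a b c : K) : a <= b ->
  (forall s, a <= s <= b -> symm (X s)) -> abs_continuous a b X -> psd (X b) ->
  (forall s, a <= s <= b -> `|A s| <= c /\ `|C s| <= c) ->
  (forall s, a < s < b -> psd (N s)) ->
  {ae mu, forall s, a < s < b ->
     is_derive s (1 : K) X (- (lyap (X s) (A s) (C s) + N s))} ->
  forall s, a <= s <= b -> psd (X s).
Proof.
move=> ab Xsym acX Xb AC psdN aeX.
have c0 : 0 <= c by have [|h _] := AC a; [rewrite lexx|exact: le_trans (normr_ge0 _) h].
pose k := growth c; have k0 : 0 <= k by exact: le_trans (growth_ge1 c0).
pose w := expw k b.
have main eps : 0 < eps -> forall s, a <= s <= b -> posdef (X s + (eps * w s)%:M).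
  move=> eps0; pose Y s := X s + (eps * w s)%:M.
  have acY : abs_continuous a b Y.
    apply: abs_continuousD => //.
    apply: (@abs_continuous_lip _ _ _ _ _ `|eps| w); last exact: abs_continuous_expw.
    move=> s t _ _; rewrite -raddfB/= -mulrBr; apply: mx_norm_le => [|i j].
      by rewrite mulr_ge0.
    by rewrite mxE; case: eqP => _; rewrite ?mulr1n ?mulr0n ?normr0 ?mulr_ge0// normrM.
  have Yc := abs_continuous_cont_on acY.
  have Ysym s : a <= s <= b -> symm (Y s).
    by move=> /Xsym sX; rewrite /symm /Y linearD/= tr_scalar_mx sX.
  have bfY s x y : bf (X s) x y = bf (Y s) x y - eps * w s * (x^T *m y) 0 0.
    by rewrite /Y bfD bf_scalar addrK.
  have wb : w b = 1 by exact: expwT.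
  apply: (posdef_barrier (Y := Y)) => //.
    split; first by apply: Ysym; rewrite ab lexx.
    move=> x x0; rewrite -[ltRHS]/(bf (Y b) x x) bfD bf_scalar_sq wb mulr1.
    by rewrite ltr_wpDl ?(psd_ge0 _ Xb)// mulr_gt0// sq_gt0.
  move=> s0 x as0 s0b posY Yx x0.
  exists (fun s => bf (Y s) x x); split => //.
  - by apply: abs_continuous_bf; exact: abs_continuousS acY.
  - by rewrite /bf -mulmxA Yx mulmx0 mxE.
  pose D := n%:R * n%:R * n%:R * c * `|x| * `|x|.
  have D0 : 0 <= D by rewrite !mulr_ge0.
  (* Allowed variation of [Y] near the contact time: times [2 * D], it stays below the margin
     [eps * sq x]. *)
  have e0 : 0 < eps * sq x / (2 * D + 1).
    by rewrite divr_gt0 ?mulr_gt0 ?sq_gt0// ltr_wpDl// mulr_ge0.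
  have s0ab : a <= s0 <= b by rewrite as0 ltW.
  have [r r0 rP] := Yc s0 _ s0ab e0.
  exists r => //; apply: ae_sub aeX => s Hs /[dup] s0sb /andP[s0s sb] sr.
  have sab : a < s < b by rewrite sb (le_lt_trans as0).
  have sab' : a <= s <= b by case/andP: sab => *; rewrite !ltW.
  have dX := Hs sab.
  exists (bf (- (lyap (X s) (A s) (C s) + N s)) x x + eps * - (k * w s) * sq x).
    have -> : (fun s => bf (Y s) x x) = (fun s => bf (X s) x x + (eps * sq x) *: w s).
      by apply/funext => t; rewrite /Y bfD bf_scalar_sq mulrAC.
    apply: (is_derive_eq (is_derive_add (is_derive_bf x x dX)
      (is_derive_scale (is_derive_expw k b s) (eps * sq x)))).
    by rewrite [X in _ = _ + X]mulrAC.
  have bfXA : bf (X s) x (A s *m x) = bf (Y s) x (A s *m x) - eps * w s * bf (A s) x x.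
    by rewrite bfY mulmxA.
  have bfXC : bf (X s) (C s *m x) (C s *m x) =
    bf (Y s) (C s *m x) (C s *m x) - eps * w s * sq (C s *m x) by rewrite bfY.
  rewrite bfN (bf_lyapD _ _ _ _ (Xsym s sab')) bfXA bfXC.
  have [As Cs] := AC s sab'.
  have gr := growthP x As Cs; rewrite -/k in gr.
  have s0sb' : s0 < s <= b by rewrite s0s ltW.
  have NY := psd_ge0 x (psdN s sab).
  have CY := psd_ge0 (C s *m x) (posdef_psd (posY s s0sb')).
  have w1 : 1 <= w s by apply: expw_ge1 => //; exact: ltW.
  have gr' : eps * w s * (2 * bf (A s) x x + sq (C s *m x)) <= eps * w s * ((k - 1) * sq x).
    by rewrite ler_wpM2l// mulr_ge0 ?(ltW eps0)// (le_trans _ w1).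
  (* As [Y s0] annihilates [x], the drift term only sees [Y s - Y s0]. *)
  have YA : - (2 * bf (Y s) x (A s *m x)) <= eps * sq x.
    have -> : bf (Y s) x (A s *m x) = bf (Y s - Y s0) x (A s *m x).
      by rewrite bfB (bf_ker _ (Ysym _ s0ab) Yx) subr0.
    have := bf_mulmx_bound (Y s - Y s0) x As; rewrite -/D.
    have : `|s - s0| < r by rewrite ger0_norm; lra.
    move=> /(rP s sab') h1 /le_trans/(_ (ler_wpM2l D0 h1)).
    rewrite ler_norml => /andP[+ _].
    have : D * (eps * sq x / (2 * D + 1)) * 2 <= eps * sq x.
      have -> : D * (eps * sq x / (2 * D + 1)) * 2 = eps * sq x * (2 * D / (2 * D + 1)) by ring.
      rewrite ler_piMr ?mulr_ge0 ?(ltW eps0) ?sq_ge0//.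
      by rewrite ler_pdivrMr ?ltr_wpDl ?mulr_ge0// mul1r lerDl.
    lra.
  have ew : eps * sq x <= eps * w s * sq x.
    by rewrite ler_wpM2r ?sq_ge0// -{1}[eps]mulr1 ler_wpM2l// ltW.
  have : eps * w s * ((k - 1) * sq x) = eps * (k * w s) * sq x - eps * w s * sq x by ring.
  have : eps * - (k * w s) * sq x = - (eps * (k * w s) * sq x) by ring.
  have : eps * w s * (2 * bf (A s) x x + sq (C s *m x)) =
    2 * (eps * w s * bf (A s) x x) + eps * w s * sq (C s *m x) by ring.
  lra.
move=> s sab; split; first exact: Xsym.
move=> x; rewrite -[leRHS]/(bf (X s) x x); apply/ler_addgt0Pr => e e0.
have w0 : 0 < w s by rewrite expR_gt0.
have sx : 0 < sq x + 1 by rewrite ltr_wpDl ?sq_ge0.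
have eps0 : 0 < e / w s / (sq x + 1) by rewrite !divr_gt0.
have := psd_ge0 x (posdef_psd (main _ eps0 s sab)); rewrite bfD bf_scalar_sq => /le_trans; apply.
rewrite lerD2l; have -> : e / w s / (sq x + 1) * w s * sq x = e * (sq x / (sq x + 1)).
  by field; rewrite !gt_eqF.
by rewrite ler_piMr ?(ltW e0)// ler_pdivrMr// mul1r lerDl.
Qed.

End positivity.

(** * Uniqueness for linear inequalities involving the diagonal *)

Section vanish.
Variables (K : realType) (p q : nat).
Notation mu := (@lebesgue_measure K).

(** Gronwall by repeated halving: a bound by a multiple of the weight of rate [4 * L] on the whole
    triangle covers row and diagonal terms alike, and integration along the rows halves the
    multiple. *)
Lemma nonlocal_vanish (E : K -> K -> 'M[K]_(p, q)) (T L B : K) : 0 <= L ->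
  (forall t s, 0 <= t -> t <= s -> s <= T -> `|E t s| <= B) ->
  (forall t, 0 <= t <= T -> abs_continuous t T (E t)) ->
  (forall t, 0 <= t <= T -> E t T = 0) ->
  (forall t, 0 <= t <= T -> {ae mu, forall s, t < s < T ->
     exists2 v, is_derive s (1 : K) (E t) v & `|v| <= L * (`|E t s| + `|E s s|)}) ->
  forall t s, 0 <= t -> t <= s -> s <= T -> E t s = 0.
Proof.
move=> L0 EB acE ET dE t s t0 ts sT.
pose w := expw (4 * L) T; have L4 : 0 <= 4 * L by rewrite mulr_ge0.
have B0 : 0 <= B by exact: le_trans (normr_ge0 _) (EB t s t0 ts sT).
have main k : forall t s, 0 <= t -> t <= s -> s <= T -> `|E t s| <= B / 2 ^+ k * w s.
  elim: k => [|k IH] {t0 ts sT s t} t s t0 ts sT.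
    rewrite expr0 divr1 (le_trans (EB _ _ t0 ts sT))// -[leLHS]mulr1 ler_wpM2l//.
    exact: expw_ge1.
  have tT : 0 <= t <= T by rewrite t0 (le_trans ts).
  have H : `|E t s - E t T| <= B / 2 ^+ k.+1 * (w s - w T).
    apply: (@ac_expw _ _ _ (E t) (4 * L) T) => //; first exact: abs_continuousS (acE t tT).
    apply: ae_sub (dE t tT) => r Hr /andP[sr rT].
    have [|v dv vL] := Hr; first by rewrite rT (le_lt_trans ts).
    have r0 : 0 <= r by rewrite (le_trans t0)// (le_trans ts)// ltW.
    exists v => //; apply: le_trans vL _.
    have := lerD (IH t r t0 (le_trans ts (ltW sr)) (ltW rT)) (IH r r r0 (lexx r) (ltW rT)).
    move=> /(ler_wpM2l L0)/le_trans; apply.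
    rewrite le_eqVlt; apply/orP; left; apply/eqP; rewrite exprS -/w -/(w r); field.
    by rewrite expf_neq0.
  move: H; rewrite ET// subr0 => /le_trans; apply.
  by rewrite ler_wpM2l ?divr_ge0 ?exprn_ge0// /w expwT gerBl.
apply/eqP; rewrite -normr_le0; apply: (@geometric_eq0 _ _ (B * w s)) => k.
by rewrite mulrAC main.
Qed.

End vanish.

(** * A priori bound on the diagonal *)

Section apriori.
Variables (K : realType) (n : nat).
Notation M := 'M[K]_n.
Notation mu := (@lebesgue_measure K).

Definition apriori_rate (c : K) : K := growth n c + n%:R * n%:R * c.

(* Z - P(s0, s) dominates Z - P(s, s), is absolutely continuous in s, unlike the
   diagonal P(s, s), and coincides with Z - P(s, s) at s = s0, the last point
   where the bound fails. *)
Lemma diagonal_bound (P N Q : K -> K -> M) (A C Ath Cth : K -> M) (T c c' b : K) :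
  0 <= T -> 1 <= b ->
  (forall s, 0 <= s <= T -> [/\ `|A s| <= c, `|C s| <= c & `|Ath s| <= c']) ->
  (forall t s, 0 <= t -> t <= s -> s <= T -> `|Q t s| <= c) ->
  (forall t s, 0 <= t -> t <= s -> s <= T -> psd (P t s) /\ psd (P s s - P t s)) ->
  (forall t, 0 <= t <= T -> abs_continuous t T (P t)) ->
  (forall s e : K, 0 <= s <= T -> 0 < e -> exists2 r : K, 0 < r &
     forall s', s <= s' -> s' <= T -> s' < s + r -> `|P s' s' - P s s'| <= e) ->
  cont_on 0 T (fun s => P s s) ->
  (forall t, 0 <= t <= T -> {ae mu, forall s, t < s < T ->
     is_derive s (1 : K) (P t) (- (lyap (P t s) (Ath s) (Cth s) + N t s))}) ->
  (forall t s x, 0 <= t -> t <= s -> s <= T ->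
     bf (lyap (P s s) (Ath s) (Cth s) + N t s) x x <=
     bf (lyap (P s s) (A s) (C s) + Q t s) x x) ->
  posdef (b%:M - P T T) ->
  forall s, 0 <= s <= T -> posdef ((b * expw (apriori_rate c) T s)%:M - P s s).
Proof.
move=> T0 b1 AC Qc psdP acP Pc pc dP Pmin pT.
have c0 : 0 <= c by have [|h _ _] := AC 0; [rewrite lexx|exact: le_trans (normr_ge0 _) h].
have c'0 : 0 <= c' by have [|_ _ h] := AC 0; [rewrite lexx|exact: le_trans (normr_ge0 _) h].
pose k := apriori_rate c.
have k0 : 0 <= k.
  by rewrite addr_ge0 ?mulr_ge0// (le_trans _ (growth_ge1 n c0)).
pose w := expw k T; pose Y s := (b * w s)%:M - P s s.
have b0 : 0 <= b by exact: le_trans b1.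
have symP t s : 0 <= t -> t <= s -> s <= T -> symm (P t s).
  by move=> h1 h2 h3; exact: (psdP t s h1 h2 h3).1.1.
have Yc : cont_on 0 T Y.
  move=> s e sT e0; have e2 : 0 < e / 2 by rewrite divr_gt0.
  have [r r0 rP] := pc s _ sT e2.
  have acw : abs_continuous 0 T (fun s => (b * w s)%:M : M).
    apply: (@abs_continuous_lip _ _ _ _ _ `|b| w); last exact: abs_continuous_expw.
    move=> u v _ _; rewrite -raddfB/= -mulrBr; apply: mx_norm_le => [|i j].
      by rewrite mulr_ge0.
    by rewrite mxE; case: eqP => _; rewrite ?mulr1n ?mulr0n ?normr0 ?mulr_ge0// normrM.
  have [r' r'0 r'P] := abs_continuous_cont_on acw sT e2.
  exists (Num.min r r'); first by rewrite lt_min r0.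
  move=> s' s'T; rewrite lt_min => /andP[sr sr'].
  rewrite /Y opprD opprK addrACA (le_trans (ler_normD _ _))// (splitr e) lerD ?r'P//.
  by rewrite addrC distrC rP.
have Ysym s : 0 <= s <= T -> symm (Y s).
  by move=> /andP[s0 sT]; rewrite /symm /Y linearB/= tr_scalar_mx symP.
apply: (posdef_barrier (Y := Y)) => //.
  by rewrite /Y /w expwT mulr1.
move=> s0 x s00 s0T posY Yx x0.
have s0T' : 0 <= s0 <= T by rewrite s00 ltW.
exists (fun s => b * w s * sq x - bf (P s0 s) x x); split.
- apply: abs_continuousB; last by apply: abs_continuous_bf; exact: acP.
  apply: (@abs_continuous_lip _ _ _ _ _ `|b * sq x| w); last exact: abs_continuous_expw.
  move=> u v _ _; have -> : b * w v * sq x - b * w u * sq x = b * sq x * (w v - w u) by ring.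
  by rewrite normrM lexx.
- have : bf (Y s0) x x = 0 by apply: bf_ker => //; exact: Ysym.
  by rewrite /Y bfB bf_scalar_sq.
- move=> s /andP[s0s sT]; rewrite /Y bfB bf_scalar_sq lerD2l lerN2 -subr_ge0 -bfB.
  by apply: psd_ge0; have [] := psdP s0 s s00 (ltW s0s) sT.
pose D := n%:R * n%:R * n%:R * c * `|x| * `|x|.
pose D' := n%:R * n%:R * n%:R * c' * `|x| * `|x|.
have D0 : 0 <= D by rewrite !mulr_ge0.
have D'0 : 0 <= D' by rewrite !mulr_ge0.
(* One tolerance for two errors: [D'] weighs the replacement of P(s0,s) by P(s,s) in the closed-loop
   drift, [D] the distance of [Y s] from its value at contact. *)
have e0 : 0 < sq x / (2 * D + 2 * D' + 1).
  by rewrite divr_gt0 ?sq_gt0// ltr_wpDl// addr_ge0// mulr_ge0.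
have [r r0 rP] := Yc s0 _ s0T' e0.
have [r' r'0 r'P] := Pc s0 _ s0T' e0.
exists (Num.min r r'); first by rewrite lt_min r0.
apply: ae_sub (dP s0 s0T') => s Hs /[dup] /Hs dPs /andP[s0s sT] sr.
have [sr1 sr2] : s < s0 + r /\ s < s0 + r'.
  by move: sr; rewrite -ltrBlDl lt_min => /andP[]; rewrite !ltrBlDl.
have sT' : 0 <= s <= T by rewrite (ltW sT) (le_trans s00 (ltW s0s)).
have s0sT : s0 < s <= T by rewrite s0s ltW.
exists (b * - (k * w s) * sq x - bf (- (lyap (P s0 s) (Ath s) (Cth s) + N s0 s)) x x).
  have -> : (fun s => b * w s * sq x - bf (P s0 s) x x) =
            (fun s => (b * sq x) *: w s - bf (P s0 s) x x).
    by apply/funext => t; rewrite mulrAC.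
  apply: (is_derive_eq (is_derive_sub
    (is_derive_scale (is_derive_expw k T s) (b * sq x)) (is_derive_bf x x dPs))).
  by rewrite [X in _ = X - _]mulrAC.
have [As Cs Aths] := AC s sT'.
have s0s' := ltW s0s; have sT2 := ltW sT; have sge0 : 0 <= s by case/andP: sT'.
have [psd0s psdds] := psdP s0 s s00 s0s' sT2.
have symd := symP s s sge0 (lexx s) sT2.
have := Pmin s0 s x s00 s0s' sT2.
rewrite bfN !bf_lyapD//; last exact: psd0s.1.
move=> HP.
(* The closed-loop diffusion term is compared by the order P(s0,s) <= P(s,s), without error; only
   drift terms cost a tolerance. *)
have H1 : bf (P s0 s) (Cth s *m x) (Cth s *m x) <= bf (P s s) (Cth s *m x) (Cth s *m x).
  by rewrite -subr_ge0 -bfB psd_ge0.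
have small (e D1 : K) : 0 <= D1 -> D1 <= D + D' -> e <= sq x / (2 * D + 2 * D' + 1) ->
    D1 * e <= D1 * (sq x / (2 * D + 2 * D' + 1)).
  by move=> ? ? ?; rewrite ler_wpM2l.
have H2 : bf (P s0 s) x (Ath s *m x) - bf (P s s) x (Ath s *m x) <=
    D' * (sq x / (2 * D + 2 * D' + 1)).
  rewrite -bfB (le_trans (ler_norm _))// (le_trans (bf_mulmx_bound _ _ Aths))// -/D'.
  by rewrite ler_wpM2l// distrC r'P.
have H3 : bf (P s s) x (A s *m x) - b * w s * bf (A s) x x <= D * (sq x / (2 * D + 2 * D' + 1)).
  have -> : bf (P s s) x (A s *m x) - b * w s * bf (A s) x x = - bf (Y s - Y s0) x (A s *m x).
    rewrite [in RHS]bfB (bf_ker _ (Ysym _ s0T') Yx) subr0 /Y bfB bf_scalar opprB.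
    by rewrite mulmxA.
  rewrite (le_trans (ler_norm _))// normrN (le_trans (bf_mulmx_bound _ _ As))// -/D.
  rewrite ler_wpM2l// rP// ger0_norm; lra.
have H4 : bf (P s s) (C s *m x) (C s *m x) <= b * w s * sq (C s *m x).
  have := psd_ge0 (C s *m x) (posdef_psd (posY s s0sT)).
  by rewrite /Y bfB bf_scalar_sq subr_ge0.
have H5 : bf (Q s0 s) x x <= n%:R * n%:R * c * sq x.
  rewrite (le_trans (ler_norm _))// (le_trans (bf_le_sq _ _))//.
  by rewrite ler_wpM2r ?sq_ge0// ler_wpM2l ?mulr_ge0// Qc.
have bw1 : 1 <= b * w s by rewrite -[1]mulr1 ler_pM// expw_ge1.
have gr : b * w s * (2 * bf (A s) x x + sq (C s *m x)) <= b * w s * ((growth n c - 1) * sq x).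
  by rewrite ler_wpM2l ?growthP// (le_trans _ bw1).
have H6 : D * (sq x / (2 * D + 2 * D' + 1)) * 2 + D' * (sq x / (2 * D + 2 * D' + 1)) * 2 <= sq x.
  have -> : D * (sq x / (2 * D + 2 * D' + 1)) * 2 + D' * (sq x / (2 * D + 2 * D' + 1)) * 2 =
    sq x * ((2 * D + 2 * D') / (2 * D + 2 * D' + 1)) by ring.
  rewrite ler_piMr ?sq_ge0// ler_pdivrMr ?mul1r ?lerDl//.
  by rewrite ltr_wpDl// addr_ge0// mulr_ge0.
(* The three pieces of the rate pay, in this order, for the terms in [A] and [C], for the two errors
   and for [Q]. *)
have H7 : b * - (k * w s) * sq x = - (b * w s * ((growth n c - 1) * sq x)) - b * w s * sq x
   - b * w s * (n%:R * n%:R * c * sq x) by rewrite /k /apriori_rate; ring.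
have H8 : n%:R * n%:R * c * sq x <= b * w s * (n%:R * n%:R * c * sq x).
  by rewrite -[leLHS]mul1r ler_wpM2r// !mulr_ge0// sq_ge0.
have H9 : sq x <= b * w s * sq x by rewrite -[leLHS]mul1r ler_wpM2r// sq_ge0.
have H10 : b * w s * (2 * bf (A s) x x + sq (C s *m x)) =
  2 * (b * w s * bf (A s) x x) + b * w s * sq (C s *m x) by ring.
rewrite H7; lra.
Qed.

End apriori.

(** * Retraction onto bounded nonnegative forms *)

Section positive_retraction.
Variables (K : realType) (n : nat).
Notation M := 'M[K]_n.
Notation nn := (n%:R * n%:R : K).
Implicit Types (X Y Z : M) (x : 'cV[K]_n).

Let forms X := [set r : K | exists2 x : 'cV[K]_n, sq x <= 1 & r = - bf X x x].

(* The smallest c >= 0 such that X + c I has a nonnegative quadratic form. *)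
Definition nu X : K := sup (forms X).

Let forms0 X : forms X 0.
Proof. by exists 0; rewrite /sq /bf !mulmx0 mxE ?oppr0. Qed.

Let has_sup_forms X : has_sup (forms X).
Proof.
split; first by exists 0; exact: forms0.
exists (nn * `|X|) => _ [x x1 ->]; rewrite (le_trans (ler_norm _))// normrN.
by rewrite (le_trans (bf_le_sq _ _))// ler_piMr// !mulr_ge0.
Qed.

Lemma nu_ge0 X : 0 <= nu X.
Proof. by apply: (sup_upper_bound (has_sup_forms X)); exact: forms0. Qed.

Lemma nu_form X x : 0 <= bf X x x + nu X * sq x.
Proof.
have [->|x0] := eqVneq x 0; first by rewrite /sq /bf !mulmx0 mxE mulr0 addr0.
have s0 := sq_gt0 x0.
pose y := (Num.sqrt (sq x))^-1 *: x.
have c2 : (Num.sqrt (sq x))^-1 * (Num.sqrt (sq x))^-1 = (sq x)^-1.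
  by rewrite -invfM -expr2 sqr_sqrtr// ltW.
have y1 : sq y = 1.
  rewrite -[sq y]mul1r -bf_scalar_sq /y bfZl bfZr mulrA c2 bf_scalar_sq mul1r.
  by rewrite mulVf// gt_eqF.
have : - bf X y y <= nu X.
  by apply: (sup_upper_bound (has_sup_forms X)); exists y; rewrite ?y1.
rewrite /y bfZl bfZr mulrA c2 -(ler_pM2r s0) -mulNr mulrAC mulNr mulVf ?gt_eqF// mulN1r.
by lra.
Qed.

Lemma nu_psd X : (forall x, 0 <= bf X x x) -> nu X = 0.
Proof.
move=> X0; apply/eqP; rewrite eq_le nu_ge0 andbT.
apply: ge_sup; first by exists 0; exact: forms0.
by move=> _ [x _ ->]; rewrite oppr_le0.
Qed.

Lemma nu_lip X Y : `|nu X - nu Y| <= nn * `|X - Y|.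
Proof.
have H U V : nu U <= nu V + nn * `|U - V|.
  apply: ge_sup; first by exists 0; exact: forms0.
  move=> _ [x x1 ->]; apply: (@le_trans _ _ (- bf V x x + nn * `|U - V|)).
    rewrite -lerBlDl opprK addrC -opprB -bfB (le_trans (ler_norm _))// normrN.
    by rewrite (le_trans (bf_le_sq _ _))// ler_piMr// !mulr_ge0.
  by rewrite lerD2r; apply: (sup_upper_bound (has_sup_forms V)); exists x.
rewrite ler_norml; have := H X Y; have := H Y X; rewrite distrC => h1 h2.
by apply/andP; split; lra.
Qed.

(** Radial retraction onto a ball; its factor is positive, so the sign of a quadratic form is
    kept. *)
Definition clip (m : K) Z : M := (m / Num.max m `|Z|) *: Z.

Lemma clip_factor m Z : 0 < m -> 0 < m / Num.max m `|Z| <= 1.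
Proof.
move=> m0; have M0 : 0 < Num.max m `|Z| by rewrite lt_max m0.
by rewrite divr_gt0//= ler_pdivrMr// mul1r le_max lexx.
Qed.

Lemma clip_bound m Z : 0 < m -> `|clip m Z| <= m.
Proof.
move=> m0; have M0 : 0 < Num.max m `|Z| by rewrite lt_max m0.
rewrite normrZ gtr0_norm ?divr_gt0// mulrAC ler_pdivrMr// ler_wpM2l ?(ltW m0)//.
by rewrite le_max lexx orbT.
Qed.

Lemma clip_id m Z : 0 < m -> `|Z| <= m -> clip m Z = Z.
Proof. by move=> m0 Zm; rewrite /clip max_l// divff ?scale1r// gt_eqF. Qed.

Lemma clip_lip m Z Z' : 0 < m -> `|clip m Z - clip m Z'| <= 2 * `|Z - Z'|.
Proof.
move=> m0; rewrite /clip; set u := Num.max m `|Z|; set v := Num.max m `|Z'|.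
have u0 : 0 < u by rewrite lt_max m0.
have v0 : 0 < v by rewrite lt_max m0.
have mu' : m <= u by rewrite le_max lexx.
have Zv : `|Z'| <= v by rewrite le_max lexx orbT.
have uv : `|u - v| <= `|Z - Z'|.
  apply: le_trans (ler_dist_dist Z Z'); rewrite /u /v !maxEle ler_norml.
  have n1 := ler_norm (`|Z| - `|Z'|); have n2 := ler_norm (`|Z'| - `|Z|).
  rewrite distrC in n2.
  by case: (leP m `|Z|) => h1; case: (leP m `|Z'|) => h2; apply/andP; split; lra.
(* One part changes the matrix and the other the factor; each is at most [|Z - Z'|]. *)
have -> : (m / u) *: Z - (m / v) *: Z' = (m / u) *: (Z - Z') + (m / u - m / v) *: Z'.
  by rewrite scalerBr scalerBl addrA subrK.
have mu1 : m / u <= 1 by rewrite ler_pdivrMr// mul1r.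
have E : m / u - m / v = (m / u) * ((v - u) / v) by field; rewrite !gt_eqF.
have h1 : `|(m / u) *: (Z - Z')| <= `|Z - Z'|.
  by rewrite normrZ (gtr0_norm (divr_gt0 m0 u0)) ler_piMl.
have h2 : `|(m / u - m / v) *: Z'| <= `|Z - Z'|.
  rewrite normrZ E normrM (gtr0_norm (divr_gt0 m0 u0)) normrM normfV (gtr0_norm v0) distrC.
  have -> : m / u * (`|u - v| / v) * `|Z'| = (m / u) * (`|u - v| * (`|Z'| / v)) by ring.
  apply: le_trans uv; rewrite (@le_trans _ _ (`|u - v| * (`|Z'| / v)))//.
    by rewrite ler_piMl// mulr_ge0// divr_ge0// ltW.
  by rewrite ler_piMr// ler_pdivrMr// mul1r.
rewrite (le_trans (ler_normD _ _))//; lra.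
Qed.

(** The shift by [nu X] stands in for a spectral projection onto the cone: it makes sense for
    nonsymmetric matrices and is Lipschitz. *)
Definition retract (m : K) X : M := clip m (X + (nu X)%:M).

Lemma retract_bound m X : 0 < m -> `|retract m X| <= m.
Proof. exact: clip_bound. Qed.

Lemma retract_form m X x : 0 < m -> 0 <= bf (retract m X) x x.
Proof.
move=> m0; rewrite bfZ mulr_ge0//; first by case/andP: (clip_factor (X + (nu X)%:M) m0) => /ltW.
by rewrite bfD bf_scalar_sq nu_form.
Qed.

(** On a nonnegative form the retraction is a mere rescaling, the case to which the optimality of
    the gain applies. *)
Lemma retract_psd m X : 0 < m -> (forall x, 0 <= bf X x x) ->
  exists2 l, 0 < l <= 1 & retract m X = l *: X.
Proof.
move=> m0 X0; exists (m / Num.max m `|X|); first exact: clip_factor.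
by rewrite /retract nu_psd// raddf0 addr0.
Qed.

Lemma retract_id m X : 0 < m -> (forall x, 0 <= bf X x x) -> `|X| <= m ->
  retract m X = X.
Proof. by move=> m0 X0 Xm; rewrite /retract nu_psd// raddf0 addr0 clip_id. Qed.

Lemma retract_lip m X Y : 0 < m -> `|retract m X - retract m Y| <= 2 * (1 + nn) * `|X - Y|.
Proof.
move=> m0; apply: le_trans (clip_lip _ _ m0) _; rewrite -mulrA ler_wpM2l//.
rewrite opprD addrACA (le_trans (ler_normD _ _))// mulrDl mul1r lerD2l -raddfB/=.
apply: le_trans (nu_lip X Y); apply: mx_norm_le => // i j.
by rewrite mxE; case: eqP => _; rewrite ?mulr1n// mulr0n normr0.
Qed.

End positive_retraction.

(** * Inverses of coercive matrices *)

Section coercive.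
Variables (K : realType) (m : nat) (S : 'M[K]_m) (d : K).
Hypotheses (d0 : 0 < d) (Sd : forall x, d * sq x <= bf S x x).

Lemma coercive_unitmx : S \in unitmx.
Proof.
rewrite unitmxE unitfE; apply/negP => /det0P[v v0 vS].
have := Sd v^T; rewrite /bf trmxK vS mul0mx mxE leNgt => /negP; apply.
rewrite mulr_gt0// sq_gt0//; apply: contra v0 => /eqP v0.
by rewrite -[v]trmxK v0 trmx0.
Qed.

(** For the column x = S^-1 e_j, coercivity reads d |x|^2 <= x_j. Hence x_j <= 1/d, and then d x_i^2
    <= 1/d for every i. No symmetry of [S] is at hand, since [S] is built from a retracted
    iterate. *)
Lemma coercive_invmx_norm : `|invmx S| <= d^-1.
Proof.
apply: mx_norm_le => [|i j]; first by rewrite invr_ge0 ltW.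
pose x := invmx S *m delta_mx j 0 : 'cV_m.
have xE k : x k 0 = invmx S k j by rewrite /x -colE mxE.
have := Sd x; rewrite {3}/x -bf_mulr mulmxV ?coercive_unitmx// bf_scalar mul1r.
rewrite -colE 2!mxE => dx.
have dxk k : d * x k 0 ^+ 2 <= x j 0.
  by apply: le_trans dx; rewrite ler_pM2l// sq_entry.
have xj0 : 0 <= x j 0 by apply: le_trans (dxk j); rewrite mulr_ge0 ?sqr_ge0// ltW.
have xjd : x j 0 <= d^-1.
  move: xj0; rewrite le_eqVlt => /predU1P[<-|xj0]; first by rewrite invr_ge0 ltW.
  have := dxk j; rewrite expr2 mulrA ger_pMl// => h.
  by rewrite -[d^-1]mul1r ler_pdivlMr// mulrC.
rewrite -xE -ler_sqr ?nnegrE ?invr_ge0 ?(ltW d0)// real_normK ?num_real//.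
rewrite expr2 -[leRHS]mulr1 -mulrA ler_pdivlMl// mulr1 -expr2.
exact: le_trans (dxk i) xjd.
Qed.

End coercive.

(** * Bounded Lipschitz and measurable matrix functions *)

Section bounded_lipschitz.
Variables (K : realType) (I W : Type) (D : W -> Prop) (d : W -> W -> K).
Hypothesis d_ge0 : forall y y', 0 <= d y y'.

(** Bounded and Lipschitz in [y], uniformly in the index [i]. Below, the index is the pair of times
    and [y] the pair formed by a row value and a diagonal value; stability under matrix operations
    then reads the estimates off the formula of the generator. *)
Definition blip p q (f : I -> W -> 'M[K]_(p, q)) :=
  exists2 c : K, 0 <= c & forall i y y', D y -> D y' ->
    `|f i y| <= c /\ `|f i y - f i y'| <= c * d y y'.

Lemma blip_cst p q (F : I -> 'M[K]_(p, q)) (c : K) :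
  (forall i, `|F i| <= c) -> blip (fun i _ => F i).
Proof.
move=> Fc; exists `|c| => // i y y' _ _; split.
  by rewrite (le_trans (Fc i))// ler_norm.
by rewrite subrr normr0 mulr_ge0.
Qed.

Lemma blipD p q (f g : I -> W -> 'M[K]_(p, q)) : blip f -> blip g ->
  blip (fun i y => f i y + g i y).
Proof.
move=> [a a0 fa] [b b0 gb]; exists (a + b); first by rewrite addr_ge0.
move=> i y y' Dy Dy'; have [fa1 fa2] := fa i y y' Dy Dy'; have [gb1 gb2] := gb i y y' Dy Dy'.
split; first by rewrite (le_trans (ler_normD _ _))// lerD.
by rewrite opprD addrACA mulrDl (le_trans (ler_normD _ _))// lerD.
Qed.

Lemma blipN p q (f : I -> W -> 'M[K]_(p, q)) : blip f -> blip (fun i y => - f i y).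
Proof.
move=> [a a0 fa]; exists a => // i y y' Dy Dy'.
by have [fa1 fa2] := fa i y y' Dy Dy'; rewrite normrN -opprD normrN.
Qed.

Lemma blip_tr p q (f : I -> W -> 'M[K]_(p, q)) : blip f -> blip (fun i y => (f i y)^T).
Proof.
move=> [a a0 fa]; exists a => // i y y' Dy Dy'.
by have [fa1 fa2] := fa i y y' Dy Dy'; rewrite -linearB/= !mx_norm_trmx.
Qed.

Lemma blipM p q r (f : I -> W -> 'M[K]_(p, q)) (g : I -> W -> 'M[K]_(q, r)) :
  blip f -> blip g -> blip (fun i y => f i y *m g i y).
Proof.
move=> [a a0 fa] [b b0 gb]; exists (q%:R * (a * b) * 2); first by rewrite !mulr_ge0.
move=> i y y' Dy Dy'; have [fa1 fa2] := fa i y y' Dy Dy'; have [gb1 gb2] := gb i y y' Dy Dy'.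
have [fa1' _] := fa i y' y Dy' Dy.
have ab : 0 <= q%:R * (a * b) by rewrite !mulr_ge0.
split.
  rewrite (le_trans (mx_norm_mulmx _ _))// (@le_trans _ _ (q%:R * (a * b)))//.
    by rewrite ler_wpM2l// ler_pM.
  by rewrite ler_peMr// ler1n.
have -> : f i y *m g i y - f i y' *m g i y' =
    (f i y - f i y') *m g i y + f i y' *m (g i y - g i y').
  by rewrite mulmxBl mulmxBr addrA subrK.
rewrite (le_trans (ler_normD _ _))//.
have -> : q%:R * (a * b) * 2 * d y y' = q%:R * ((a * d y y') * b) + q%:R * (a * (b * d y y')).
  by ring.
by rewrite lerD// (le_trans (mx_norm_mulmx _ _))// ler_wpM2l// ler_pM.
Qed.

Lemma blip_inv p (S : I -> W -> 'M[K]_p) (e : K) : 0 < e ->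
  (forall i y x, e * sq x <= bf (S i y) x x) -> blip S -> blip (fun i y => invmx (S i y)).
Proof.
move=> e0 Se [a a0 Sa].
have Sb i y := coercive_invmx_norm e0 (Se i y).
have Su i y := coercive_unitmx e0 (Se i y).
have e1 : 0 <= e^-1 by rewrite invr_ge0 ltW.
exists (e^-1 + p%:R * (p%:R * (e^-1 * a) * e^-1)); first by rewrite addr_ge0// !mulr_ge0.
move=> i y y' Dy Dy'; have [_ Sa2] := Sa i y y' Dy Dy'; split.
  by rewrite (le_trans (Sb i y))// lerDl !mulr_ge0.
have -> : invmx (S i y) - invmx (S i y') =
    invmx (S i y) *m (S i y' - S i y) *m invmx (S i y').
  by rewrite mulmxBr mulVmx// mulmxBl mul1mx -mulmxA mulmxV// mulmx1.
rewrite mulrDl (@le_trans _ _ (p%:R * (p%:R * (e^-1 * a) * e^-1) * d y y'))//; last first.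
  by rewrite lerDr mulr_ge0.
have -> : p%:R * (p%:R * (e^-1 * a) * e^-1) * d y y' =
  p%:R * (p%:R * (e^-1 * (a * d y y')) * e^-1) by ring.
rewrite (le_trans (mx_norm_mulmx _ _))// ler_wpM2l// ler_pM//.
rewrite (le_trans (mx_norm_mulmx _ _))// ler_wpM2l// ler_pM//.
by rewrite distrC.
Qed.

End bounded_lipschitz.

(** * Measurability of matrix functions *)

Section mx_measurable.
Variable K : realType.

Definition mx_measurable p q (F : K -> 'M[K]_(p, q)) :=
  forall i j, measurable_fun setT (fun s => F s i j).

Lemma mx_measurable_continuous p q (F : K -> 'M[K]_(p, q)) : continuous F -> mx_measurable F.
Proof.
move=> cF i j; apply: continuous_measurable_fun => s.
exact: (@continuous_comp _ _ _ F (fun M => M i j) s (cF s) (@coord_continuous K p q i j (F s))).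
Qed.

Lemma mx_measurableD p q (F G : K -> 'M[K]_(p, q)) : mx_measurable F -> mx_measurable G ->
  mx_measurable (fun s => F s + G s).
Proof. by move=> mF mG i j; under eq_fun do rewrite mxE; exact: measurable_funD. Qed.

Lemma mx_measurableN p q (F : K -> 'M[K]_(p, q)) : mx_measurable F ->
  mx_measurable (fun s => - F s).
Proof. by move=> mF i j; under eq_fun do rewrite mxE; exact: measurable_funN. Qed.

Lemma mx_measurable_tr p q (F : K -> 'M[K]_(p, q)) : mx_measurable F ->
  mx_measurable (fun s => (F s)^T).
Proof. by move=> mF i j; under eq_fun do rewrite mxE; exact: mF. Qed.

Lemma mx_measurableM p q r (F : K -> 'M[K]_(p, q)) (G : K -> 'M[K]_(q, r)) :
  mx_measurable F -> mx_measurable G -> mx_measurable (fun s => F s *m G s).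
Proof.
move=> mF mG i j; under eq_fun do rewrite mxE.
by apply: measurable_sum => k; exact: measurable_funM.
Qed.

Lemma measurable_det p (F : K -> 'M[K]_p) : mx_measurable F ->
  measurable_fun setT (fun s => \det (F s)).
Proof.
move=> mF; apply: measurable_sum => sg; apply: measurable_funM => //.
by apply: measurable_prod.
Qed.

Lemma measurable_inv (f : K -> K) : measurable_fun setT f -> (forall s, f s != 0) ->
  measurable_fun setT (fun s => (f s)^-1).
Proof.
move=> mf f0; apply: (@measurable_comp _ _ _ _ _ _ [set x : K | x != 0] GRing.inv) => //.
- by apply: open_measurable; apply: open_neq.
- by move=> _ [s _ <-]; exact: f0.
- apply: open_continuous_measurable_fun; first by apply: open_neq.
  by move=> x; rewrite inE/= => x0; exact: inv_continuous.
Qed.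

(** Cramer's rule reduces the inverse to determinants and a scalar reciprocal. *)
Lemma mx_measurable_inv p (F : K -> 'M[K]_p) : mx_measurable F ->
  (forall s, F s \in unitmx) -> mx_measurable (fun s => invmx (F s)).
Proof.
move=> mF uF i j.
have -> : (fun s => invmx (F s) i j) = (fun s => (\det (F s))^-1 * cofactor (F s) j i).
  by apply/funext => s; rewrite /invmx uF !mxE.
apply: measurable_funM.
  apply: measurable_inv; first exact: measurable_det.
  by move=> s; rewrite -unitfE -unitmxE.
apply: measurable_funM => //; apply: measurable_det => k l.
by under eq_fun do rewrite !mxE; exact: mF.
Qed.

End mx_measurable.

(** * Compactness and uniform continuity *)

Section topology.
Variable K : realType.

(** Compactness of [0,T] makes the continuity in t uniform in s. *)
Lemma uniform_near (V : normedModType K) (F : K -> K -> V) (T t e : K) :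
  continuous (fun p : K * K => F p.1 p.2) -> 0 < e ->
  \forall t' \near t, forall s, 0 <= s <= T -> `|F t s - F t' s| <= e.
Proof.
move=> cF e0.
have /compact_near_coveringP/(_ K (nbhs t) (fun t' s => `|F t s - F t' s| <= e)) :=
  @segment_compact K 0 T.
move=> /(_ (nbhs_filter t)) near_cov.
have cov s : `[0, T]%classic s ->
    \forall s' \near s & t' \near t, `|F t s' - F t' s'| <= e.
  move=> _; have e2 : 0 < e / 2 by rewrite divr_gt0.
  have /cvgrPdist_le/(_ _ e2)[[U V'] [/= tU sV] UV] := cF (t, s).
  exists (V', U) => //= -[s' t'] [/= Vs' Ut'].
  rewrite -(subrKA (F t s)) (le_trans (ler_normD _ _))// (splitr e) lerD//.
    by rewrite distrC; apply: (UV (t, s')); split => //; exact: nbhs_singleton.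
  exact: (UV (t', s')).
apply: filterS (near_cov cov) => t' H s sT; apply: H.
by rewrite /= in_itv.
Qed.

Lemma continuous_comp_into (X Y Z : topologicalType) (A : set Y) (f : Y -> Z) (g : X -> Y) :
  {within A, continuous f} -> continuous g -> (forall x, A (g x)) -> continuous (f \o g).
Proof.
move=> /subspace_continuousP cf cg Ag x.
apply: cvg_trans (cf (g x) (Ag x)) => B /= fB.
have := cg x _ fB; rewrite /nbhs/=.
by apply: filterS => y H; exact: H (Ag y).
Qed.

Lemma square_bounded (V : normedModType K) (F : K * K -> V) (T : K) : continuous F ->
  exists B : K, forall t s, 0 <= t <= T -> 0 <= s <= T -> `|F (t, s)| <= B.
Proof.
move=> cF.
have /compact_bounded[B [_ HB]] : compact (F @` (`[0, T]%classic `*` `[0, T]%classic)).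
  apply: continuous_compact; first exact: continuous_subspaceT.
  by apply: compact_setX; exact: segment_compact.
exists (B + 1) => t s tT sT; apply: (HB (B + 1)); first by rewrite ltrDl.
by exists (t, s) => //=; rewrite !in_itv.
Qed.

End topology.

(** * The equilibrium Riccati equation with regularised data *)

Section lyap_facts.
Variables (K : realType) (n : nat).
Implicit Types X Y A C : 'M[K]_n.

Lemma lyapB X Y A C : lyap (X - Y) A C = lyap X A C - lyap Y A C.
Proof.
rewrite /lyap !(mulmxBl, mulmxBr) !opprD [RHS]addrACA; congr (_ + _).
by rewrite [RHS]addrACA.
Qed.

Lemma lyap0 A C : lyap (0 : 'M[K]_n) A C = 0.
Proof. by rewrite /lyap !(mulmx0, mul0mx) !addr0. Qed.

Lemma lyap_tr X A C : (lyap X A C)^T = lyap X^T A C.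
Proof. by rewrite /lyap !linearD/= !trmx_mul !trmxK mulmxA [in LHS](addrC (A^T *m _)). Qed.

Definition lyap_rate (c : K) : K := n%:R * c + n%:R * c + n%:R * n%:R * (c * c).

Lemma lyap_bound X A C (c : K) : `|A| <= c -> `|C| <= c -> `|lyap X A C| <= lyap_rate c * `|X|.
Proof.
move=> Ac Cc; have c0 : 0 <= c by exact: le_trans Ac.
rewrite /lyap_rate mulrDl mulrDl.
rewrite (le_trans (ler_normD _ _))// lerD//.
  rewrite (le_trans (ler_normD _ _))// lerD// (le_trans (mx_norm_mulmx _ _))//.
    by rewrite -mulrA ler_wpM2l// mulrC ler_wpM2r.
  by rewrite -mulrA ler_wpM2l// mx_norm_trmx ler_wpM2r.
rewrite (le_trans (mx_norm_mulmx _ _))// -!mulrA ler_wpM2l//.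
have -> : n%:R * (c * (c * `|X|)) = (n%:R * (c * `|X|)) * c by ring.
apply: ler_pM => //; rewrite (le_trans (mx_norm_mulmx _ _))// ler_wpM2l//.
by rewrite mx_norm_trmx ler_wpM2r.
Qed.

End lyap_facts.

Section equilibrium.
Variables (K : realType) (n m : nat) (T c delta : K).
Variables (A C : K -> 'M[K]_n) (B D : K -> 'M[K]_(n, m)).
Variables (G : K -> 'M[K]_n) (Q : K -> K -> 'M[K]_n) (R : K -> K -> 'M[K]_m).
Notation M := 'M[K]_n.
Notation mu := (@lebesgue_measure K).

(** Feedback with the diagonal value as a free argument [q], so that the retracted value can be
    substituted for it. *)
Definition gain (s : K) (q : M) : 'M[K]_(m, n) :=
  - (invmx (R s s + (D s)^T *m q *m D s) *m ((B s)^T *m q + (D s)^T *m q *m C s)).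

Definition drift (s : K) (Th : 'M[K]_(m, n)) : M := A s + B s *m Th.
Definition diffusion (s : K) (Th : 'M[K]_(m, n)) : M := C s + D s *m Th.
Definition running (t s : K) (Th : 'M[K]_(m, n)) : M := Q t s + Th^T *m R t s *m Th.

Definition gen (t s : K) (X : M) (Th : 'M[K]_(m, n)) : M :=
  lyap X (drift s Th) (diffusion s Th) + running t s Th.

Hypothesis T0 : 0 <= T.
Hypothesis c0 : 0 <= c.
Hypothesis delta0 : 0 < delta.
Hypothesis bA : forall s, `|A s| <= c.
Hypothesis bB : forall s, `|B s| <= c.
Hypothesis bC : forall s, `|C s| <= c.
Hypothesis bD : forall s, `|D s| <= c.
Hypothesis bG : forall t, `|G t| <= c.
Hypothesis bQ : forall t s, `|Q t s| <= c.
Hypothesis bR : forall t s, `|R t s| <= c.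
Hypothesis mA : mx_measurable A.
Hypothesis mB : mx_measurable B.
Hypothesis mC : mx_measurable C.
Hypothesis mD : mx_measurable D.
Hypothesis cG : continuous G.
Hypothesis cQ : continuous (fun p : K * K => Q p.1 p.2).
Hypothesis cR : continuous (fun p : K * K => R p.1 p.2).
Hypothesis sQ : forall t s, symm (Q t s).
Hypothesis sR : forall t s, symm (R t s).
Hypothesis pQ : forall t s, t <= s -> psd (Q t s).
Hypothesis pR : forall t s x, t <= s -> delta * sq x <= bf (R t s) x x.
Hypothesis pG : forall t, psd (G t).
Hypothesis monQ : forall t r s, t <= r -> r <= s -> psd (Q r s - Q t s).
Hypothesis monR : forall t r s, t <= r -> r <= s -> psd (R r s - R t s).
Hypothesis monG : forall t r, t <= r -> psd (G r - G t).

Lemma psdR t s : t <= s -> psd (R t s).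
Proof.
move=> ts; split=> // x; apply: le_trans (pR x ts).
by rewrite mulr_ge0 ?sq_ge0// ltW.
Qed.

Lemma weight_coercive s q x : (forall y, 0 <= bf q y y) ->
  delta * sq x <= bf (R s s + (D s)^T *m q *m D s) x x.
Proof.
move=> q0; rewrite bfD -mulmxA bf_mull bf_mulr (le_trans (pR x (lexx s)))// lerDl.
exact: q0.
Qed.

Lemma running_psd t s Th : t <= s -> psd (running t s Th).
Proof. by move=> ts; apply: psdD; [exact: pQ|exact/psd_congr/psdR]. Qed.

Lemma running_tr t s Th : (running t s Th)^T = running t s Th.
Proof. by rewrite /running linearD/= !trmx_mul trmxK sR sQ mulmxA. Qed.

Lemma running_mono t r s Th : t <= r -> r <= s -> psd (running r s Th - running t s Th).
Proof.
move=> tr rs; rewrite /running opprD addrACA -mulmxBl -mulmxBr.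
by apply: psdD; [exact: monQ|exact/psd_congr/monR].
Qed.

Lemma gen_tr t s X Th : (gen t s X Th)^T = gen t s X^T Th.
Proof. by rewrite /gen [LHS]linearD/= lyap_tr running_tr. Qed.

Lemma genB t s X Y Th : gen t s X Th - gen t s Y Th =
  lyap (X - Y) (drift s Th) (diffusion s Th).
Proof. by rewrite /gen lyapB opprD addrACA subrr addr0. Qed.

(* gain s (l p) minimises the form of l times the Lyapunov part plus R(s,s), with
   value at most that of the zero gain; since l <= 1 and R(t,s) <= R(s,s), this
   survives the division by l. *)
Lemma gain_optimal t s l (p : M) x : t <= s -> 0 < l <= 1 -> psd p ->
  bf (lyap p (drift s (gain s (l *: p))) (diffusion s (gain s (l *: p))) +
      running t s (gain s (l *: p))) x x <=
  bf (lyap p (A s) (C s) + Q t s) x x.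
Proof.
move=> ts /andP[l0 l1] psdp; have [sp _] := psdp.
set Th := gain s (l *: p); pose y := Th *m x.
pose S := R s s + (D s)^T *m (l *: p) *m D s.
have uS : S \in unitmx.
  apply: (@coercive_unitmx _ _ _ delta) => // z; apply: weight_coercive => w.
  by rewrite bfZ mulr_ge0 ?(ltW l0)// psd_ge0.
have STh : S *m Th = - ((B s)^T *m (l *: p) + (D s)^T *m (l *: p) *m C s).
  by rewrite /Th /gain -/S mulmxN mulmxA mulmxV// mul1mx.
have Syy : bf S y y = - (l * bf p x (B s *m y)) - l * bf p (C s *m x) (D s *m y).
  rewrite {2}/y -bf_mulr STh bfN bfD opprD bf_mull -mulmxA bf_mull bf_mulr !bfZ.
  by rewrite (bf_sym _ x sp) (bf_sym _ (C s *m x) sp).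
have Syy2 : bf S y y = bf (R s s) y y + l * bf p (D s *m y) (D s *m y).
  by rewrite /S bfD -mulmxA bf_mull bf_mulr bfZ.
have rho := psd_ge0 y (psdR (lexx s)).
have pi0 := psd_ge0 (D s *m y) psdp.
have Rm := psd_ge0 y (monR ts (lexx s)); rewrite bfB subr_ge0 in Rm.
have key : 2 * bf p x (B s *m y) + 2 * bf p (C s *m x) (D s *m y) +
    bf p (D s *m y) (D s *m y) <= - bf (R s s) y y.
  rewrite -(ler_pM2l l0).
  have : l * bf (R s s) y y <= bf (R s s) y y by rewrite ler_piMl.
  have : 0 <= l * bf p (D s *m y) (D s *m y) by rewrite mulr_ge0// ltW.
  have -> : l * (2 * bf p x (B s *m y) + 2 * bf p (C s *m x) (D s *m y) +
    bf p (D s *m y) (D s *m y)) = 2 * (l * bf p x (B s *m y)) +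
    2 * (l * bf p (C s *m x) (D s *m y)) + l * bf p (D s *m y) (D s *m y) by ring.
  rewrite mulrN; lra.
rewrite !bf_lyapD// /running bfD -(mulmxA Th^T) bf_mull bf_mulr -/y.
have -> : drift s Th *m x = A s *m x + B s *m y by rewrite mulmxDl -mulmxA.
have -> : diffusion s Th *m x = C s *m x + D s *m y by rewrite mulmxDl -mulmxA.
rewrite !bfDl !bfDr (bf_sym (D s *m y) (C s *m x) sp); lra.
Qed.

(** * The truncated equation *)

Section truncated.
Variable M0 : K.
Hypothesis M0_gt0 : 0 < M0.

Definition cgain s (Y : M) := gain s (retract M0 Y).
Definition cgen t s (X Y : M) := gen t s X (cgain s Y).

(** Only the row value is confined to a ball; the diagonal value ranges freely, the retraction
    taking care of it. *)
Let Dom N (y : M * M) := `|y.1| <= N.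
Let dist (y y' : M * M) : K := `|y.1 - y'.1| + `|y.2 - y'.2|.
Notation bl N := (@blip K (K * K) (M * M) (Dom N) dist _ _).

Let dist_ge0 y y' : 0 <= dist y y'. Proof. by rewrite addr_ge0. Qed.

Lemma cgain_blip N : bl N (fun i y => cgain i.2 y.2).
Proof.
have bq : bl N (fun i y => retract M0 y.2).
  exists (M0 + 2 * (1 + n%:R * n%:R)).
    by rewrite addr_ge0 ?(ltW M0_gt0)// mulr_ge0// addr_ge0// mulr_ge0.
  move=> i y y' _ _; split.
    by rewrite (le_trans (retract_bound _ M0_gt0))// lerDl mulr_ge0// addr_ge0// mulr_ge0.
  apply: (le_trans (retract_lip _ _ M0_gt0)); apply: ler_pM => //.
  - by rewrite lerDr ltW.
  - by rewrite lerDr.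
have bB' : bl N (fun i y => B i.2) by apply: (@blip_cst _ _ _ _ _ dist_ge0 _ _ _ c) => i; exact: bB.
have bC' : bl N (fun i y => C i.2) by apply: (@blip_cst _ _ _ _ _ dist_ge0 _ _ _ c) => i; exact: bC.
have bD' : bl N (fun i y => D i.2) by apply: (@blip_cst _ _ _ _ _ dist_ge0 _ _ _ c) => i; exact: bD.
have bR' : bl N (fun i y => R i.2 i.2).
  by apply: (@blip_cst _ _ _ _ _ dist_ge0 _ _ _ c) => i; exact: bR.
rewrite /cgain /gain; apply: blipN; apply: blipM => //.
  apply: (@blip_inv _ _ _ _ _ _ _ _ delta) => //.
    by move=> i y x; apply: weight_coercive => z; exact: retract_form.
  apply: blipD => //; apply: blipM => //; apply: blipM => //; exact: blip_tr.
apply: blipD => //; first by apply: blipM => //; exact: blip_tr.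
by apply: blipM => //; apply: blipM => //; exact: blip_tr.
Qed.

Lemma cgen_blip N : bl N (fun i y => cgen i.1 i.2 y.1 y.2).
Proof.
have bX : bl N (fun i y => y.1).
  exists (`|N| + 1); first by rewrite addr_ge0.
  move=> i y y' Dy _; split.
    by rewrite (le_trans Dy)// (le_trans (ler_norm _))// lerDl.
  by rewrite /dist -[leLHS]mul1r ler_pM// ?lerDr// lerDl.
have bA' : bl N (fun i y => A i.2) by apply: (@blip_cst _ _ _ _ _ dist_ge0 _ _ _ c) => i; exact: bA.
have bB' : bl N (fun i y => B i.2) by apply: (@blip_cst _ _ _ _ _ dist_ge0 _ _ _ c) => i; exact: bB.
have bC' : bl N (fun i y => C i.2) by apply: (@blip_cst _ _ _ _ _ dist_ge0 _ _ _ c) => i; exact: bC.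
have bD' : bl N (fun i y => D i.2) by apply: (@blip_cst _ _ _ _ _ dist_ge0 _ _ _ c) => i; exact: bD.
have bQ' : bl N (fun i y => Q i.1 i.2).
  by apply: (@blip_cst _ _ _ _ _ dist_ge0 _ _ _ c) => i; exact: bQ.
have bR' : bl N (fun i y => R i.1 i.2).
  by apply: (@blip_cst _ _ _ _ _ dist_ge0 _ _ _ c) => i; exact: bR.
have bTh := cgain_blip N.
have bAT : bl N (fun i y => drift i.2 (cgain i.2 y.2)).
  by apply: blipD => //; exact: blipM.
have bCT : bl N (fun i y => diffusion i.2 (cgain i.2 y.2)).
  by apply: blipD => //; exact: blipM.
rewrite /cgen /gen /lyap /running; apply: blipD => //; apply: blipD => //.
- by apply: blipD => //; apply: blipM => //; exact: blip_tr.
- by apply: blipM => //; apply: blipM => //; exact: blip_tr.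
- by apply: blipM => //; apply: blipM => //; exact: blip_tr.
Qed.

Lemma cgain_bound : exists2 c1, 0 <= c1 & forall s Y, `|cgain s Y| <= c1.
Proof.
have [c1 c10 H] := cgain_blip 0; exists c1 => // s Y.
have D0 : Dom 0 (0, Y) by rewrite /Dom normr0.
by have [] := H (s, s) _ _ D0 D0.
Qed.

Lemma coef_bound : exists2 c2, 0 <= c2 & forall s Y,
  `|drift s (cgain s Y)| <= c2 /\ `|diffusion s (cgain s Y)| <= c2.
Proof.
have [c1 c10 Hc1] := cgain_bound.
exists (c + m%:R * (c * c1)); first by rewrite addr_ge0// !mulr_ge0.
by move=> s Y; split; rewrite (le_trans (ler_normD _ _))// lerD//;
  rewrite (le_trans (mx_norm_mulmx _ _))// ler_wpM2l// ler_pM.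
Qed.

(** For a fixed diagonal value the generator is affine in the row with bounded coefficients; this
    linear growth rules out blow-up on [0,T]. *)
Lemma cgen_bound : exists2 a, 0 < a & forall t s X Y, `|cgen t s X Y| <= a * (1 + `|X|).
Proof.
have [c2 c20 Hc2] := coef_bound.
have [a1 a10 Ha1] := cgen_blip 0.
have r0 : 0 <= lyap_rate n c2 by rewrite !addr_ge0// !mulr_ge0.
exists (a1 + lyap_rate n c2 + 1); first by rewrite ltr_wpDl// addr_ge0.
move=> t s X Y; have [h1 h2] := Hc2 s Y.
have D0 : Dom 0 (0, Y) by rewrite /Dom normr0.
have [H _] := Ha1 (t, s) _ _ D0 D0.
have -> : cgen t s X Y = lyap X (drift s (cgain s Y)) (diffusion s (cgain s Y)) + cgen t s 0 Y.
  by rewrite /cgen /gen lyap0 add0r.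
rewrite (le_trans (ler_normD _ _))//.
have h3 := lyap_bound X h1 h2.
apply: le_trans (lerD h3 H) _.
have : 0 <= a1 * `|X| by rewrite mulr_ge0.
have := normr_ge0 X.
have -> : (a1 + lyap_rate n c2 + 1) * (1 + `|X|) =
  a1 + lyap_rate n c2 + 1 + a1 * `|X| + lyap_rate n c2 * `|X| + `|X| by ring.
lra.
Qed.

Lemma cgain_measurable (p : K -> M) : continuous p -> mx_measurable (fun s => cgain s (p s)).
Proof.
move=> cp.
have mq : mx_measurable (fun s => retract M0 (p s)).
  apply: mx_measurable_continuous => s.
  apply: (continuous_comp (cp s)).
  by apply: (@lipschitz_continuous _ _ _ _ (2 * (1 + n%:R * n%:R))) => x y; exact: retract_lip.
have mR : mx_measurable (fun s => R s s).
  apply: mx_measurable_continuous.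
  by apply: (continuous_curry_comp cR (f := id) (g := id)) => s; exact: cvg_id.
rewrite /cgain /gain; apply: mx_measurableN; apply: mx_measurableM.
  apply: mx_measurable_inv.
    apply: mx_measurableD => //; apply: mx_measurableM => //.
    by apply: mx_measurableM => //; exact: mx_measurable_tr.
  move=> s; apply: (@coercive_unitmx _ _ _ delta) => // z; apply: weight_coercive => y.
  exact: retract_form.
apply: mx_measurableD; first by apply: mx_measurableM => //; exact: mx_measurable_tr.
by apply: mx_measurableM => //; apply: mx_measurableM => //; exact: mx_measurable_tr.
Qed.

Lemma cgen_measurable t (P p : K -> M) : continuous P -> continuous p ->
  mx_measurable (fun s => cgen t s (P s) (p s)).
Proof.
move=> cP cp; have mTh := cgain_measurable cp.
have mP := mx_measurable_continuous cP.
have mQ : mx_measurable (fun s => Q t s).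
  apply: mx_measurable_continuous.
  by apply: (continuous_curry_comp cQ (f := cst t) (g := id)) => s; [exact: cvg_cst|exact: cvg_id].
have mR : mx_measurable (fun s => R t s).
  apply: mx_measurable_continuous.
  by apply: (continuous_curry_comp cR (f := cst t) (g := id)) => s; [exact: cvg_cst|exact: cvg_id].
have mAT : mx_measurable (fun s => drift s (cgain s (p s))).
  by apply: mx_measurableD => //; exact: mx_measurableM.
have mCT : mx_measurable (fun s => diffusion s (cgain s (p s))).
  by apply: mx_measurableD => //; exact: mx_measurableM.
rewrite /cgen /gen /lyap /running.
by repeat (first [exact: mP | exact: mQ | exact: mR | exact: mTh | exact: mAT | exact: mCT
  | apply: mx_measurable_tr | apply: mx_measurableM | apply: mx_measurableD]).
Qed.

Lemma cgen_near t e : 0 < e ->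
  \forall t' \near t, forall s X Y, 0 <= s <= T -> `|cgen t s X Y - cgen t' s X Y| <= e.
Proof.
move=> e0; have [c1 c10 Hc1] := cgain_bound.
pose r := m%:R * (m%:R * (c1 * c1)); have r0 : 0 <= r by rewrite !mulr_ge0.
have e1 : 0 < e / 2 by rewrite divr_gt0.
have e2 : 0 < e / 2 / (r + 1) by rewrite !divr_gt0// ltr_wpDl.
have nQ := uniform_near T t cQ e1.
have nR := uniform_near T t cR e2.
near=> t' => s X Y sT.
have hQ : forall s : K, 0 <= s <= T -> `|Q t s - Q t' s| <= e / 2 by near: t'.
have hR : forall s : K, 0 <= s <= T -> `|R t s - R t' s| <= e / 2 / (r + 1) by near: t'.
(* The Lyapunov terms cancel: only [Q] and [R] depend on t. *)
rewrite /cgen /gen opprD addrACA subrr add0r /running opprD addrACA -mulmxBl -mulmxBr.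
rewrite (le_trans (ler_normD _ _))// (splitr e) lerD ?hQ//.
apply: (@le_trans _ _ (r * (e / 2 / (r + 1)))).
  rewrite (le_trans (mx_norm_mulmx _ _))//.
  have -> : r * (e / 2 / (r + 1)) = m%:R * (m%:R * (c1 * (e / 2 / (r + 1))) * c1).
    by rewrite /r; ring.
  rewrite ler_wpM2l// ler_pM// (le_trans (mx_norm_mulmx _ _))// ler_wpM2l// ler_pM ?hR//.
  by rewrite mx_norm_trmx.
rewrite mulrCA ler_piMr ?(ltW e1)// ler_pdivrMr ?mul1r ?lerDl// ltr_wpDl//.
Unshelve. all: by end_near. Qed.

Lemma truncated_solution : exists P : K -> K -> M, [/\
  forall t e : K, 0 < e -> \forall t' \near t, forall s : K, 0 <= s <= T -> `|P t s - P t' s| <= e,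
  exists2 l, 0 <= l & forall t s s', `|P t s - P t s'| <= l * `|s - s'|,
  exists N, forall t s : K, 0 <= s <= T -> `|P t s| <= N,
  forall t, P t T = G t &
  forall t, {ae mu, forall s, 0 < s < T ->
    is_derive s (1 : K) (P t) (- cgen t s (P t s) (P s s))}].
Proof.
have [a a0 Ha] := cgen_bound.
apply: (@picard K n T cgen G a c) => //.
- by move=> t P p cP cp i j; exact: cgen_measurable.
- move=> N; have [L L0 HL] := cgen_blip N.
  exists (L + 1); first by rewrite ltr_wpDl.
  move=> t s X X' Y Y' XN X'N.
  have [_ H] := HL (t, s) (X, Y) (X', Y') XN X'N.
  apply: le_trans H _; rewrite ler_wpM2r ?lerDl//.
- move=> N t e e0; apply: filterS (cgen_near t e0) => t' H s X Y sT _.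
  exact: H.
Qed.

Section properties.
Variable P : K -> K -> M.
Hypothesis P_unif : forall t e : K, 0 < e ->
  \forall t' \near t, forall s : K, 0 <= s <= T -> `|P t s - P t' s| <= e.
Hypothesis P_lip : exists2 l : K, 0 <= l & forall t s s', `|P t s - P t s'| <= l * `|s - s'|.
Hypothesis P_bound : exists N : K, forall t s : K, 0 <= s <= T -> `|P t s| <= N.
Hypothesis P_T : forall t, P t T = G t.
Hypothesis P_ode : forall t, {ae mu, forall s, 0 < s < T ->
  is_derive s (1 : K) (P t) (- cgen t s (P t s) (P s s))}.

Lemma truncated_ac t a b : abs_continuous a b (P t).
Proof.
have [l l0 Pl] := P_lip.
by apply: (@lipschitz_abs_continuous _ _ _ _ l) => x y _ _.
Qed.

Let P_ode_sub t r : 0 <= r -> {ae mu, forall s, r < s < T ->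
  is_derive s (1 : K) (P t) (- cgen t s (P t s) (P s s))}.
Proof.
move=> r0; apply: ae_sub (P_ode t) => s H /andP[rs sT]; apply: H.
by rewrite sT (le_lt_trans r0).
Qed.

(** The gain depends on the diagonal only, so P - P^T along a row solves a linear homogeneous
    equation with zero terminal value. *)
Lemma truncated_symm t s : 0 <= s <= T -> symm (P t s).
Proof.
move=> /andP[s0 sT].
have [c2 c20 Hc2] := coef_bound; have [N PN] := P_bound.
have trlip a b : abs_continuous a b (fun s => (P t s)^T).
  apply: (@abs_continuous_lip _ _ _ _ _ 1 (P t)) => [x y _ _|]; last exact: truncated_ac.
  by rewrite -linearB/= mx_norm_trmx mul1r.
apply/esym/eqP; rewrite -subr_eq0; apply/eqP.
(* The row is fixed: the family is constant in its first argument and its diagonal is the row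
   itself. *)
apply: (@nonlocal_vanish K n n (fun _ s => P t s - (P t s)^T) T (lyap_rate n c2) (N + N)
  _ _ _ _ _ s s) => //.
- by rewrite !addr_ge0// !mulr_ge0.
- move=> r u r0 ru uT; have uT' : 0 <= u <= T by rewrite uT (le_trans r0).
  by rewrite (le_trans (ler_normB _ _))// mx_norm_trmx lerD// PN.
- by move=> r rT; apply: abs_continuousB => //; exact: truncated_ac.
- by move=> r _; rewrite P_T (pG t).1 subrr.
- move=> r /andP[r0 _]; apply: ae_sub (P_ode_sub t r0) => u Hu ruT.
  have dP := Hu ruT; have [h1 h2] := Hc2 u (P u u).
  have dPT : is_derive u (1 : K) (fun s => (P t s)^T) (- cgen t u (P t u) (P u u))^T.
    apply: is_derive_mx => i j; rewrite mxE.
    have -> : (fun s => (P t s)^T i j) = (fun s => P t s j i) by apply/funext => z; rewrite mxE.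
    exact: is_derive_entry.
  exists (- cgen t u (P t u) (P u u) - (- cgen t u (P t u) (P u u))^T).
    exact: is_derive_sub.
  have -> : - cgen t u (P t u) (P u u) - (- cgen t u (P t u) (P u u))^T =
      - lyap (P t u - (P t u)^T) (drift u (cgain u (P u u))) (diffusion u (cgain u (P u u))).
    by rewrite [X in _ - X]linearN/= gen_tr -(genB t) opprB opprK addrC.
  rewrite normrN (le_trans (lyap_bound _ h1 h2))// ler_wpM2l ?lerDl//.
  by rewrite !addr_ge0// !mulr_ge0.
Qed.

Lemma truncated_psd t s : 0 <= t -> t <= s -> s <= T -> psd (P t s).
Proof.
move=> t0 ts sT; have [c2 c20 Hc2] := coef_bound.
have tT : t <= T by exact: le_trans ts sT.
apply: (@lyapunov_psd K n (P t) (fun s => drift s (cgain s (P s s)))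
  (fun s => diffusion s (cgain s (P s s))) (fun s => running t s (cgain s (P s s))) t T c2) => //.
- by move=> r /andP[tr rT]; apply: truncated_symm; rewrite rT (le_trans t0).
- exact: truncated_ac.
- by rewrite P_T.
- by move=> r /andP[tr rT]; apply: running_psd; exact: ltW.
- exact: P_ode_sub.
- by rewrite ts.
Qed.

(** All rows share the same closed-loop coefficients, so a difference of rows solves a Lyapunov
    equation with the difference of the running terms as source. *)
Lemma truncated_mono t r s : 0 <= t -> t <= r -> r <= s -> s <= T -> psd (P r s - P t s).
Proof.
move=> t0 tr rs sT; have [c2 c20 Hc2] := coef_bound.
have rT : r <= T by exact: le_trans rs sT.
have r0 : 0 <= r by exact: le_trans tr.
apply: (@lyapunov_psd K n (fun s => P r s - P t s) (fun s => drift s (cgain s (P s s)))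
  (fun s => diffusion s (cgain s (P s s)))
  (fun s => running r s (cgain s (P s s)) - running t s (cgain s (P s s))) r T c2) => //.
- move=> u /andP[ru uT]; have uT' : 0 <= u <= T by rewrite uT (le_trans r0).
  by rewrite /symm linearB/= !truncated_symm.
- by apply: abs_continuousB; exact: truncated_ac.
- by rewrite !P_T; exact: monG.
- by move=> u /andP[ru uT]; apply: running_mono => //; exact: ltW.
- apply: ae_sub (ae_and (P_ode_sub r r0) (P_ode_sub t r0)) => u [H1 H2] ru.
  apply: (is_derive_eq (is_derive_sub (H1 ru) (H2 ru))).
  rewrite lyapB /cgen /gen opprK opprD addrACA [RHS]opprD !opprB.
  by congr (_ + _); rewrite addrC.
- by rewrite rs.
Qed.

(** The truncation level [M0] is absent from this bound, which can therefore be taken as the level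
    itself. *)
Definition diag_radius : K := (n%:R * n%:R * c + 1) * expw (apriori_rate n c) T 0.

Lemma truncated_diag_norm s : 0 <= s <= T -> `|P s s| <= diag_radius.
Proof.
move=> sT; have [s0 sT'] := andP sT; have [c2 c20 Hc2] := coef_bound.
have nn0 : 0 <= n%:R * n%:R * c by rewrite !mulr_ge0.
have k0 : 0 <= apriori_rate n c.
  by rewrite addr_ge0// (le_trans _ (growth_ge1 n c0)).
pose b := n%:R * n%:R * c + 1.
have H : posdef ((b * expw (apriori_rate n c) T s)%:M - P s s).
  apply: (@diagonal_bound K n P (fun t s => running t s (cgain s (P s s))) Q A C
    (fun s => drift s (cgain s (P s s))) (fun s => diffusion s (cgain s (P s s))) T c c2) => //.
  - by rewrite /b lerDr.
  - by move=> r _; have [h1 _] := Hc2 r (P r r).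
  - by move=> t r t0 tr rT; split; [exact: truncated_psd|apply: truncated_mono].
  - by move=> t _; exact: truncated_ac.
  (* [P u u] is compared with [P r u] by continuity in the first time at [r], uniform in the
     second. *)
  - move=> r e rT e0.
    have [d /= d0 dP] := (nbhs_ballP _ _).1 (P_unif r e0).
    exists d => // u ru uT ud; rewrite distrC; apply: dP.
      by rewrite /ball/= distrC ger0_norm ?subr_ge0// ltrBlDl.
    by case/andP: rT => r0 _; rewrite uT (le_trans r0).
  - move=> r e rT e0; have e2 : 0 < e / 2 by rewrite divr_gt0.
    have [d /= d0 dP] := (nbhs_ballP _ _).1 (P_unif r e2).
    have [d' d'0 d'P] := abs_continuous_cont_on (@truncated_ac r 0 T) rT e2.
    exists (Num.min d d'); first by rewrite lt_min d0.
    move=> u uT; rewrite lt_min => /andP[ud ud'].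
    rewrite -(subrKA (P r u)) (le_trans (ler_normD _ _))// (splitr e) lerD ?d'P//.
    by rewrite distrC; apply: dP => //; rewrite /ball/= distrC.
  - by move=> t /andP[t0 _]; exact: P_ode_sub.
  - move=> t r x t0 tr rT; have r0 : 0 <= r by exact: le_trans tr.
    have pP := truncated_psd r0 (lexx r) rT.
    have [l l01 E] := retract_psd M0_gt0 pP.2.
    by rewrite /cgain E; exact: gain_optimal.
  - split; first by rewrite /symm linearB/= tr_scalar_mx P_T (pG T).1.
    move=> x x0; rewrite -[ltRHS]/(bf (b%:M - P T T) x x) bfB bf_scalar_sq subr_gt0 P_T.
    rewrite (le_lt_trans (ler_norm _))// (le_lt_trans (bf_le_sq _ _))//.
    rewrite ltr_pM2r ?sq_gt0// /b ltr_pwDr//.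
    by rewrite ler_wpM2l ?mulr_ge0.
have pP := truncated_psd s0 (lexx s) sT'.
have z0 : 0 <= diag_radius by rewrite mulr_ge0 ?expR_ge0// addr_ge0.
have diag i : 0 <= P s s i i <= diag_radius.
  rewrite -bf_delta psd_ge0//=.
  have := psd_ge0 (delta_mx i 0) (posdef_psd H).
  rewrite bfB bf_scalar_sq subr_ge0 => /le_trans; apply.
  have -> : sq (delta_mx i 0 : 'cV[K]_n) = 1.
    by rewrite -[LHS]mul1r -bf_scalar_sq bf_delta mxE eqxx.
  by rewrite mulr1 /diag_radius ler_wpM2l ?expw_le// addr_ge0.
apply: mx_norm_le => // i j.
(* Off-diagonal entries are controlled by the diagonal ones. *)
have := psd_CauchySchwarz (delta_mx i 0) (delta_mx j 0) pP; rewrite !bf_delta => CS.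
have [/andP[i0 i1] /andP[j0 j1]] := (diag i, diag j).
rewrite -ler_sqr ?nnegrE// real_normK ?num_real//.
by rewrite (le_trans CS)// expr2 ler_pM.
Qed.

End properties.

End truncated.

Lemma diag_radius_gt0 : 0 < diag_radius.
Proof. by rewrite mulr_gt0 ?expR_gt0// ltr_wpDl// !mulr_ge0. Qed.

Lemma cgainE M0 s (p : M) : 0 < M0 -> psd p -> `|p| <= M0 -> cgain M0 s p = gain s p.
Proof. by move=> M00 [_ p0] pM; rewrite /cgain retract_id. Qed.

Lemma equilibrium_exists : exists (P : K -> K -> M) (Th : K -> 'M[K]_(m, n)),
  [/\ continuous (fun p : K * K => P p.1 (clamp T p.2)),
    forall t s, 0 <= t -> t <= s -> s <= T -> psd (P t s),
    forall t a b, abs_continuous a b (P t),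
    forall t, P t T = G t &
    forall t, 0 <= t -> {ae mu, forall s, t < s < T ->
      is_derive s (1 : K) (P t) (- gen t s (P t s) (gain s (P s s)))}] /\
  [/\ mx_measurable Th, exists b, forall s, `|Th s| <= b &
    forall s, 0 <= s <= T -> Th s = gain s (P s s)].
Proof.
have M0 := diag_radius_gt0.
have [P [P_unif P_lip P_bound P_T P_ode]] := truncated_solution M0.
have [l l0 Pl] := P_lip.
have cP : continuous (fun p : K * K => P p.1 (clamp T p.2)).
  by apply: (clamp_joint_continuous T0 P_unif (l := l)) => t s s' _ _; exact: Pl.
have psdP := truncated_psd M0 P_lip P_bound P_T P_ode.
have Pd := truncated_diag_norm M0 P_unif P_lip P_bound P_T P_ode.
have cgE s : 0 <= s <= T -> cgain diag_radius s (P s s) = gain s (P s s).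
  move=> sT; have [s0 sT'] := andP sT.
  by rewrite cgainE ?Pd//; exact: psdP.
(* Truncated and clamped, the gain is Borel and bounded on the whole line; on [0,T] it is the true
   gain. *)
exists P, (fun s => cgain diag_radius s (P (clamp T s) (clamp T s))); split; split.
- exact: cP.
- exact: psdP.
- by move=> t a b; exact: truncated_ac.
- exact: P_T.
- move=> t t0; apply: ae_sub (P_ode t) => s H /andP[ts sT].
  have s0 : 0 < s by exact: le_lt_trans ts.
  have sT0 : 0 < s < T by rewrite s0.
  by rewrite -cgE; [exact: H|rewrite !ltW].
- apply: cgain_measurable => //; have cc := @clamp_continuous K T.
  have := continuous_curry_comp (F := fun t s => P t (clamp T s)) cP cc cc.
  by under eq_fun do rewrite clamp_clamp//.
- by have [b _ bP] := cgain_bound M0; exists b.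
- by move=> s sT; rewrite clamp_id// cgE.
Qed.

(** What uniqueness asks of a solution: the bound on the triangle places two solutions under a
    common truncation level. *)
Definition equilibrium_solution (P : K -> K -> M) := [/\
  forall t s, 0 <= t -> t <= s -> s <= T -> psd (P t s),
  exists N, forall t s, 0 <= t -> t <= s -> s <= T -> `|P t s| <= N,
  forall t, 0 <= t <= T -> abs_continuous t T (P t),
  forall t, 0 <= t <= T -> P t T = G t &
  forall t, 0 <= t <= T -> {ae mu, forall s, t < s < T ->
      is_derive s (1 : K) (P t) (- gen t s (P t s) (gain s (P s s)))}].

Lemma equilibrium_unique P P' : equilibrium_solution P -> equilibrium_solution P' ->
  forall t s, 0 <= t -> t <= s -> s <= T -> P' t s = P t s.
Proof.
move=> [psdP [N PN] acP PT dP] [psdP' [N' PN'] acP' PT' dP'] t s t0 ts sT.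
pose M0 := `|N| + `|N'| + 1.
have M00 : 0 < M0 by rewrite ltr_wpDl// addr_ge0.
have NM : N <= M0 by rewrite /M0 -addrA (le_trans (ler_norm _))// lerDl addr_ge0.
have NM' : N' <= M0.
  by rewrite /M0 addrAC (le_trans (ler_norm N'))// lerDr addr_ge0.
have PM u v : 0 <= u -> u <= v -> v <= T -> `|P u v| <= M0.
  by move=> h1 h2 h3; exact: le_trans (PN _ _ h1 h2 h3) NM.
have PM' u v : 0 <= u -> u <= v -> v <= T -> `|P' u v| <= M0.
  by move=> h1 h2 h3; exact: le_trans (PN' _ _ h1 h2 h3) NM'.
have [L L0 HL] := cgen_blip M00 M0.
apply/eqP; rewrite -subr_eq0; apply/eqP.
apply: (@nonlocal_vanish K n n (fun t s => P' t s - P t s) T L (M0 + M0)) => //.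
- move=> u v h1 h2 h3; rewrite (le_trans (ler_normB _ _))// lerD//; [exact: PM'|exact: PM].
- by move=> u uT; apply: abs_continuousB; [exact: acP'|exact: acP].
- by move=> u uT; rewrite PT'// PT// subrr.
move=> u uT; apply: ae_sub (ae_and (dP' u uT) (dP u uT)) => v [H1 H2] uv.
have [u0 uT'] := andP uT; have [uv1 uv2] := andP uv.
have v0 : 0 <= v by rewrite (le_trans u0)// ltW.
have vT : v <= T by exact: ltW.
exists (- gen u v (P' u v) (gain v (P' v v)) - - gen u v (P u v) (gain v (P v v))).
  exact: is_derive_sub (H1 uv) (H2 uv).
have [_ H] := HL (u, v) (P' u v, P' v v) (P u v, P v v)
  (PM' _ _ u0 (ltW uv1) vT) (PM _ _ u0 (ltW uv1) vT).
rewrite opprK addrC distrC; apply: le_trans H.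
have e1 : cgain M0 v (P' v v) = gain v (P' v v).
  by apply: cgainE => //; [exact: psdP'|exact: PM'].
have e2 : cgain M0 v (P v v) = gain v (P v v).
  by apply: cgainE => //; [exact: psdP|exact: PM].
by rewrite /cgen/= e1 e2.
Qed.

End equilibrium.

(** * From regularised to essentially bounded data *)

Section Linfty_facts.
Variable K : realType.
Notation mu := (@lebesgue_measure K).

Lemma bounded_Lfun (f : K -> K) b : measurable_fun setT f -> (forall s, `|f s| <= b) ->
  f \in Lfun mu +oo%E.
Proof.
move=> mf fb; apply/andP; split; rewrite inE//=.
rewrite /finite_norm unlock /Lnorm; case: ifPn => _; last by rewrite ltry.
apply: (@le_lt_trans _ _ b%:E); last by rewrite ltry.
by apply/ess_supP; apply: aeW => s /=; rewrite lee_fin.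
Qed.

Lemma Lfun_ae_bounded (f : K -> K) : f \in Lfun mu +oo%E ->
  measurable_fun setT f /\ exists b, {ae mu, forall s, `|f s| <= b}.
Proof.
(* The norm of infinite order unfolds to an essential supremum once the measure is known to be
   nonzero. *)
have mu0 : (0 < mu [set: K])%E by rewrite -set_itvNyy lebesgue_measure_itv/= ltry.
move=> /andP[]; rewrite !inE/= => mf; rewrite /finite_norm unlock /Lnorm mu0 => fin; split => //.
exact: (@ess_supr_bounded _ _ _ mu (fun s => `|f s|)).
Qed.

Lemma ae_ord (I : finType) (P : I -> K -> Prop) : (forall i, {ae mu, forall s, P i s}) ->
  {ae mu, forall s, forall i, P i s}.
Proof.
move=> H; have FF := ae_filter_ringOfSetsType mu.
by apply: (@filter_forall K _ _ _ FF) => i; exact: H.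
Qed.

Lemma ae_neq (a : K) : {ae mu, forall s, s != a}.
Proof.
exists [set a]; split; [exact: measurable_set1|exact: lebesgue_measure_set1|].
by move=> s /= /negP; rewrite negbK => /eqP.
Qed.

(** Clipping every entry at a common essential bound gives a Borel representative bounded
    everywhere, altered on a null set only. *)
Lemma Linfty_bounded T p q (F : K -> 'M[K]_(p, q)) : Linfty T F ->
  exists F0 c, [/\ mx_measurable F0, forall s, `|F0 s| <= c &
    {ae mu, forall s, 0 <= s <= T -> F s = F0 s}].
Proof.
move=> [F1 [LF aeF]].
have /choice[b bP] (ij : 'I_p * 'I_q) : exists b, {ae mu, forall s, `|F1 s ij.1 ij.2| <= b}.
  by have [_] := Lfun_ae_bounded (LF ij.1 ij.2).
pose c := \sum_ij `|b ij|.
have c0 : 0 <= c by exact: sumr_ge0.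
have bc ij : b ij <= c.
  by rewrite /c (bigD1 ij)//= (le_trans (ler_norm _))// lerDl sumr_ge0.
exists (fun s => \matrix_(i, j) Num.max (- c) (Num.min (F1 s i j) c)), c; split.
- move=> i j; under eq_fun do rewrite mxE.
  apply: measurable_maxr; first exact: measurable_cst.
  apply: measurable_minr; last exact: measurable_cst.
  exact: (Lfun_ae_bounded (LF i j)).1.
- move=> s; apply: mx_norm_le => // i j; rewrite mxE ler_norml le_max lexx/= ge_max.
  by rewrite ge_min lexx orbT andbT -subr_ge0 opprK addr_ge0.
- apply: ae_sub (ae_and aeF (ae_ord bP)) => s [H1 H2] sT.
  rewrite H1 /= ?in_itv//; apply/matrixP => i j; rewrite mxE.
  have := le_trans (H2 (i, j)) (bc (i, j)); rewrite ler_norml /= => /andP[h1 h2].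
  by rewrite min_l// max_r.
Qed.

Lemma bounded_Linfty T p q (F F0 : K -> 'M[K]_(p, q)) c : mx_measurable F0 ->
  (forall s, `|F0 s| <= c) -> {ae mu, forall s, 0 <= s <= T -> F s = F0 s} -> Linfty T F.
Proof.
move=> mF0 bF0 aeF; exists F0; split.
  move=> i j; apply: (@bounded_Lfun _ c); first exact: mF0.
  by move=> s; exact: le_trans (mx_norm_entry _ _ _) (bF0 s).
by apply: ae_sub aeF => s H /=; rewrite in_itv/=.
Qed.

End Linfty_facts.

(** * Extension of continuous data beyond their domain *)

Section extension.
Variables (K : realType) (T : K).
Hypothesis T0 : 0 <= T.

Lemma clamp_extension_continuous (V : topologicalType) (F : K -> V) :
  {within `[0, T]%classic, continuous F} -> continuous (fun t => F (clamp T t)).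
Proof.
move=> cF; have cl t : `[0, T]%classic (clamp T t) by rewrite /= in_itv/= clamp_itv.
exact: (@continuous_comp_into _ _ _ _ F (clamp T) cF (@clamp_continuous K T) cl).
Qed.

Lemma continuous_pairing (X Y Z : topologicalType) (f : X -> Y) (g : X -> Z) :
  continuous f -> continuous g -> continuous (fun x => (f x, g x)).
Proof. by move=> cf cg x; apply: cvg_pair; [exact: cf|exact: cg]. Qed.

Lemma continuous_fst_comp (X Y Z : topologicalType) (f : X -> Z) :
  continuous f -> continuous (fun p : X * Y => f p.1).
Proof. by move=> cf p; exact: (@cvg_comp _ _ _ fst f _ _ _ cvg_fst (cf p.1)). Qed.

Lemma continuous_snd_comp (X Y Z : topologicalType) (f : Y -> Z) :
  continuous f -> continuous (fun p : X * Y => f p.2).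
Proof. by move=> cf p; exact: (@cvg_comp _ _ _ snd f _ _ _ cvg_snd (cf p.2)). Qed.

Lemma clamp2_extension_continuous (V : topologicalType) (F : K -> K -> V) :
  {within `[0, T]%classic `*` `[0, T]%classic, continuous (fun p : K * K => F p.1 p.2)} ->
  continuous (fun p : K * K => F (clamp T p.1) (clamp T p.2)).
Proof.
move=> cF; have cc := @clamp_continuous K T.
have cg : continuous (fun p : K * K => (clamp T p.1, clamp T p.2)).
  by apply: continuous_pairing; [exact: continuous_fst_comp|exact: continuous_snd_comp].
have cl (p : K * K) : (`[0, T]%classic `*` `[0, T]%classic) (clamp T p.1, clamp T p.2).
  by rewrite /= !in_itv/= !clamp_itv.
exact: (@continuous_comp_into _ _ _ _ (fun p : K * K => F p.1 p.2) _ cF cg cl).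
Qed.

Lemma clamp2_extension_bounded (V : normedModType K) (F : K -> K -> V) :
  {within `[0, T]%classic `*` `[0, T]%classic, continuous (fun p : K * K => F p.1 p.2)} ->
  exists b : K, forall t s, `|F (clamp T t) (clamp T s)| <= b.
Proof.
move=> /clamp2_extension_continuous/(square_bounded T)[b bP]; exists b => t s.
by have := bP _ _ (clamp_itv t T0) (clamp_itv s T0); rewrite /= !clamp_clamp.
Qed.

Lemma clamp_extension_bounded (V : normedModType K) (F : K -> V) :
  {within `[0, T]%classic, continuous F} -> exists b : K, forall t, `|F (clamp T t)| <= b.
Proof.
move=> /clamp_extension_continuous cF.
have [b bP] := square_bounded T (@continuous_fst_comp _ K _ _ cF); exists b => t.
by have := bP _ _ (clamp_itv t T0) (clamp_itv t T0); rewrite /= clamp_clamp.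
Qed.

Lemma triangle_bounded (V : normedModType K) (F : K -> K -> V) :
  {within triangle T, continuous (fun p : K * K => F p.1 p.2)} ->
  exists b : K, forall t s, 0 <= t -> t <= s -> s <= T -> `|F t s| <= b.
Proof.
move=> cF; have cc := @clamp_continuous K T.
(* A continuous retraction of the plane onto the triangle, so boundedness follows from that of a
   continuous function on the square. *)
pose g (p : K * K) := (clamp T p.1, Num.max (clamp T p.1) (clamp T p.2)).
have cg : continuous g.
  apply: continuous_pairing; first exact: continuous_fst_comp.
  move=> p; apply: (@continuous_max _ _ (fun p : K * K => clamp T p.1)
    (fun p : K * K => clamp T p.2)).
    exact: continuous_fst_comp.
  exact: continuous_snd_comp.
have gT p : triangle T (g p).
  have /andP[h1 h2] := clamp_itv p.1 T0; have /andP[h3 h4] := clamp_itv p.2 T0.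
  split; first exact: h1.
  by split; [rewrite /= le_max lexx|rewrite /= ge_max h2 h4].
have [b bP] := square_bounded T
  (@continuous_comp_into _ _ _ _ (fun p : K * K => F p.1 p.2) _ cF cg gT).
exists b => t s t0 ts sT.
have tT : 0 <= t <= T by rewrite t0 (le_trans ts).
have sT' : 0 <= s <= T by rewrite sT (le_trans t0).
by have := bP t s tT sT'; rewrite /g/= !clamp_id// max_r.
Qed.

End extension.

(** * Existence and uniqueness for the original data *)

Lemma riccati_eqE (V : zmodType) (d a b e q r : V) :
  d + a + b + e + q + r = d + (a + b + e + (q + r)).
Proof. by rewrite !addrA. Qed.

Unset Implicit Arguments.

Theorem proposition5p1 (K : realType) (n m : nat) (T : K)
    (A : K -> 'M[K]_n) (B : K -> 'M[K]_(n, m))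
    (C : K -> 'M[K]_n) (D : K -> 'M[K]_(n, m))
    (G : K -> 'M[K]_n) (Q : K -> K -> 'M[K]_n) (R : K -> K -> 'M[K]_m)
    (T_gt0 : 0 < T)
    (A_Linfty : Linfty T A) (B_Linfty : Linfty T B)
    (C_Linfty : Linfty T C) (D_Linfty : Linfty T D)
    (G_cont : {within `[0, T]%classic, continuous G})
    (G_symm : forall t : K, `[0, T]%classic t -> symm (G t))
    (Q_cont : {within `[0, T]%classic `*` `[0, T]%classic,
                 continuous (fun p : K * K => Q p.1 p.2)})
    (Q_symm : forall t s : K, `[0, T]%classic t -> `[0, T]%classic s -> symm (Q t s))
    (R_cont : {within `[0, T]%classic `*` `[0, T]%classic,
                 continuous (fun p : K * K => R p.1 p.2)})
    (R_symm : forall t s : K, `[0, T]%classic t -> `[0, T]%classic s -> symm (R t s))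
    (positivity : exists2 delta : K, 0 < delta &
       forall t s : K, 0 <= t -> t <= s -> s <= T ->
         [/\ loewner 0 (Q t s), loewner delta%:M (R t s) & loewner 0 (G t)])
    (monotonicity : exists (Qhat : 'M[K]_n) (Rhat : 'M[K]_m) (Ghat : 'M[K]_n),
       [/\ posdef Qhat, posdef Rhat, posdef Ghat &
       forall t r s : K, 0 <= t -> t <= r -> r <= s -> s <= T ->
         [/\ loewner (Q t s) (Q r s) /\ loewner (Q r s) Qhat,
             loewner (R t s) (R r s) /\ loewner (R r s) Rhat &
             loewner (G t) (G r) /\ loewner (G r) Ghat]]) :
  exists P : K -> K -> 'M[K]_n,
    [/\ riccati_solution T A B C D G Q R P,
        forall P' : K -> K -> 'M[K]_n, riccati_solution T A B C D G Q R P' ->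
          forall t s : K, triangle T (t, s) -> P' t s = P t s
      & Linfty T (Theta B C D R P)].
Proof.
have T0 := ltW T_gt0.
have [delta delta0 pos] := positivity.
have [Qh [Rh [Gh [_ _ _ mon]]]] := monotonicity.
have [A0 [cA [mA bA eA]]] := Linfty_bounded A_Linfty.
have [B0 [cB [mB bB eB]]] := Linfty_bounded B_Linfty.
have [C0 [cC [mC bC eC]]] := Linfty_bounded C_Linfty.
have [D0 [cD [mD bD eD]]] := Linfty_bounded D_Linfty.
pose G0 t := G (clamp T t).
pose Q0 t s := Q (clamp T t) (clamp T s).
pose R0 t s := R (clamp T t) (clamp T s).
have [cG bG] := clamp_extension_bounded T0 G_cont.
have [cQ bQ] := clamp2_extension_bounded T0 Q_cont.
have [cR bR] := clamp2_extension_bounded T0 R_cont.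
pose c := `|cA| + `|cB| + `|cC| + `|cD| + `|cG| + `|cQ| + `|cR|.
have nA := normr_ge0 cA; have nB := normr_ge0 cB; have nC := normr_ge0 cC.
have nD := normr_ge0 cD; have nG := normr_ge0 cG; have nQ := normr_ge0 cQ.
have nR := normr_ge0 cR.
have c0 : 0 <= c by rewrite /c; lra.
have {}bA s : `|A0 s| <= c by have := bA s; have := ler_norm cA; rewrite /c; lra.
have {}bB s : `|B0 s| <= c by have := bB s; have := ler_norm cB; rewrite /c; lra.
have {}bC s : `|C0 s| <= c by have := bC s; have := ler_norm cC; rewrite /c; lra.
have {}bD s : `|D0 s| <= c by have := bD s; have := ler_norm cD; rewrite /c; lra.
have {}bG t : `|G0 t| <= c by have := bG t; have := ler_norm cG; rewrite /c; lra.
have {}bQ t s : `|Q0 t s| <= c by have := bQ t s; have := ler_norm cQ; rewrite /c; lra.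
have {}bR t s : `|R0 t s| <= c by have := bR t s; have := ler_norm cR; rewrite /c; lra.
have cl t := clamp_itv t T0.
have in0T t : 0 <= t <= T -> `[0, T]%classic t by rewrite /= in_itv.
(* The clamp is monotone: it sends ordered times anywhere on the line to ordered times in [0,T], so
   the sign and order conditions become global. *)
have pos0 t s : t <= s -> [/\ psd (Q0 t s), loewner delta%:M (R0 t s) & psd (G0 t)].
  move=> /(clamp_mono T) ts; have /andP[t0 _] := cl t; have /andP[_ sT] := cl s.
  by have [] := pos _ _ t0 ts sT; rewrite /loewner !subr0.
have mon0 t r s : t <= r -> r <= s ->
    [/\ psd (Q0 r s - Q0 t s), psd (R0 r s - R0 t s) & psd (G0 r - G0 t)].
  move=> /(clamp_mono T) tr /(clamp_mono T) rs.
  have /andP[t0 _] := cl t; have /andP[_ sT] := cl s.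
  by have [[? _] [? _] [? _]] := mon _ _ _ t0 tr rs sT.
have pR t s x : t <= s -> delta * sq x <= bf (R0 t s) x x.
  move=> /pos0[_ + _] => -[_ /(_ x)].
  by rewrite -[X in 0 <= X -> _]/(bf (R0 t s - delta%:M) x x) bfB bf_scalar_sq subr_ge0.
have coefE : {ae @lebesgue_measure K, forall s, 0 <= s <= T ->
    [/\ A s = A0 s, B s = B0 s, C s = C0 s & D s = D0 s]}.
  apply: ae_sub (ae_and (ae_and eA eB) (ae_and eC eD)) => s [[hA hB] [hC hD]] sT.
  by rewrite hA ?hB ?hC ?hD.
have ThetaE P s : 0 <= s <= T -> [/\ A s = A0 s, B s = B0 s, C s = C0 s & D s = D0 s] ->
    Theta B C D R P s = gain C0 B0 D0 R0 s (P s s).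
  by move=> sT [_ hB hC hD]; rewrite /Theta /gain /R0 clamp_id// hB hC hD.
have odeE P t s : 0 <= t <= T -> 0 <= s <= T ->
    [/\ A s = A0 s, B s = B0 s, C s = C0 s & D s = D0 s] ->
    let Th := Theta B C D R P in let ATh s := A s + B s *m Th s in
    let CTh s := C s + D s *m Th s in
    derive1 (P t) s + P t s *m ATh s + (ATh s)^T *m P t s
          + (CTh s)^T *m P t s *m CTh s
          + Q t s + (Th s)^T *m R t s *m Th s =
    derive1 (P t) s + gen A0 C0 B0 D0 Q0 R0 t s (P t s) (gain C0 B0 D0 R0 s (P s s)).
  move=> tT sT hs /=; rewrite (ThetaE P s sT hs); have [-> -> -> ->] := hs.
  have QE : Q0 t s = Q t s by rewrite /Q0 !clamp_id.
  have RE : R0 t s = R t s by rewrite /R0 !clamp_id.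
  by rewrite riccati_eqE /gen /running QE RE.
have sQ t s : symm (Q0 t s) by apply: Q_symm; apply: in0T.
have sR t s : symm (R0 t s) by apply: R_symm; apply: in0T.
have pQ t s : t <= s -> psd (Q0 t s) by case/pos0.
have pG t : psd (G0 t) by have [] := pos0 t t (lexx t).
have monQ t r s : t <= r -> r <= s -> psd (Q0 r s - Q0 t s).
  by move=> tr rs; have [] := mon0 t r s tr rs.
have monR t r s : t <= r -> r <= s -> psd (R0 r s - R0 t s).
  by move=> tr rs; have [] := mon0 t r s tr rs.
have monG t r : t <= r -> psd (G0 r - G0 t).
  by move=> tr; have [] := mon0 t r r tr (lexx r).
have contG : continuous G0 by exact: clamp_extension_continuous.
have contQ := clamp2_extension_continuous T0 Q_cont.
have contR := clamp2_extension_continuous T0 R_cont.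
have [P [Th [[cP psdP acP PT dP] [mTh [b bTh] ThE]]]] :=
  @equilibrium_exists K n m T c delta A0 C0 B0 D0 G0 Q0 R0 T0 c0 delta0
  bA bB bC bD bG bQ bR mA mB mC mD contG contQ contR sQ sR pQ pR pG monQ monR monG.
have toT t : `[0, T]%classic t -> 0 <= t <= T by rewrite /= in_itv.
have solP : riccati_solution T A B C D G Q R P.
  split.
  (* On the triangle the clamp in the second time is the identity. *)
  - apply: (@subspace_eq_continuous _ _ _ (fun p : K * K => P p.1 (clamp T p.2))); last first.
      exact: continuous_subspaceT.
    move=> p; rewrite inE => -[p0 [p12 pT]]; rewrite clamp_id// pT.
    by rewrite (le_trans p0).
  - by move=> t s [t0 [ts sT]]; exact: psdP.
  - by move=> t _; exact: acP.
  - move=> t /toT tT; have /andP[t0 _] := tT.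
    (* The equation is known on the open interval and claimed on the closed one, so the end points
       are discarded as null sets. *)
    apply: ae_sub (ae_and (ae_and coefE (dP t t0)) (ae_and (ae_neq t) (ae_neq T))).
    move=> s [[hs ds] [st sT]]; rewrite /= in_itv/= => /andP[ts sT'].
    have s0T : 0 <= s <= T by rewrite sT' (le_trans t0).
    have sI : t < s < T by rewrite !lt_neqAle eq_sym st sT ts sT'.
    have [dPs EP] := ds sI; split; first exact: dPs.
    by rewrite (odeE P t s tT s0T (hs s0T)) derive1E EP addNr.
  - by move=> t /toT tT; rewrite PT /G0 clamp_id.
have toeq P' : riccati_solution T A B C D G Q R P' ->
    equilibrium_solution T A0 C0 B0 D0 G0 Q0 R0 P'.
  move=> [cP' psdP' acP' dP' PT']; split.
  - by move=> t s t0 ts sT; apply: psdP'.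
  - exact: triangle_bounded cP'.
  - by move=> t /in0T; exact: acP'.
  - by move=> t tT; rewrite PT' /G0 ?clamp_id//; exact: in0T.
  - move=> t tT; have /andP[t0 _] := tT.
    apply: ae_sub (ae_and coefE (dP' t (in0T _ tT))) => s [hs ds] /andP[ts sT].
    have s0T : 0 <= s <= T by rewrite (ltW sT) (le_trans t0 (ltW ts)).
    have [|dPs] := ds; first by rewrite /= in_itv/= !ltW.
    rewrite (odeE P' t s tT s0T (hs s0T)) derive1E => /eqP; rewrite addr_eq0 => /eqP E.
    exact: DeriveDef.
exists P; split => //.
- move=> P' solP' t s [t0 [ts sT]].
  exact: (equilibrium_unique delta0 bA bB bC bD bQ bR pR (toeq P solP) (toeq P' solP')).
(* [Th] serves as the Borel representative: it agrees with [Theta] wherever the coefficients agree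
   with theirs. *)
- apply: (bounded_Linfty mTh bTh); apply: ae_sub coefE => s hs sT.
  by rewrite ThE// ThetaE//; exact: hs.
Qed.
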